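(* Let $g\in C(\partial\Omega)$. Assume that $\Omega$ is convex and that for each $x_0\in\partial\Omega$ and $r>0$ the function $g$ is not constant on $\partial\Omega\cap B(x_0,r)$. Then for each $\varepsilon>0$ there exists a constant $\delta>0$ such that, if $f\in C(\Omega)\cap L^\infty(\Omega)$ and $\|f\|_{L^\infty(\Omega)}\le\delta$, then the boundary-value problem $$-\Delta^\varepsilon_\infty u=f\ \text{ in }\Omega,\qquad u=g\ \text{ on }\partial\Omega$$ has a unique bounded solution $u:\bar\Omega\to\mathbb{R}$.
   Context: $\Omega\subseteq\mathbb{R}^n$ is a bounded, connected, open set; $B(x_0,r)$ is the open Euclidean ball. For $x,y\in\bar\Omega$, $d(x,y)$ is the path distance: the infimum of the lengths of Lipschitz paths $\gamma:[0,1]\to\bar\Omega$ with $\gamma(0)=x$, $\gamma(1)=y$ (for convex $\Omega$ this is the Euclidean distance). Write $\bar\Omega(x,r):=\{y\in\bar\Omega: d(x,y)\le r\}$. For $\varepsilon>0$ set $\rho_\varepsilon(x,y):=\max\{d(x,y),\varepsilon\}$ if $x,y\in\Omega$, and $\rho_\varepsilon(x,y):=d(x,y)$ if $x\in\partial\Omega$ or $y\in\partial\Omega$. For $u:\bar\Omega\to\mathbb{R}$ and $x\in\Omega$, $$S^+_\varepsilon u(x):=\sup_{y\in\bar\Omega(x,\varepsilon)}\frac{u(y)-u(x)}{\rho_\varepsilon(x,y)},\quad S^-_\varepsilon u(x):=\sup_{y\in\bar\Omega(x,\varepsilon)}\frac{u(x)-u(y)}{\rho_\varepsilon(x,y)},\quad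 \Delta^\varepsilon_\infty u(x):=\frac1\varepsilon\big(S^+_\varepsilon u(x)-S^-_\varepsilon u(x)\big).$$ The equation is understood pointwise. *)

(* Defs.v *)
From HB Require Import structures.
From mathcomp Require Export all_boot all_order all_algebra.
From mathcomp Require Export all_classical all_reals all_analysis.

Set Implicit Arguments.
Unset Strict Implicit.
Unset Printing Implicit Defensive.

Import Order.TTheory GRing.Theory Num.Theory.
Export numFieldNormedType.Exports.

Local Open Scope classical_set_scope.
Local Open Scope ring_scope.

Section Defs.
Context {R : realType} {n : nat}.
Implicit Types (Omega A : set 'rV[R]_n) (x y : 'rV[R]_n) (u f g : 'rV[R]_n -> R).

(* The library norm on 'rV[R]_n is the sup norm; it induces the usual topology
   and the same bounded sets and Lipschitz paths, but lengths, distances and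
   balls must be measured with the Euclidean norm. *)
Definition enorm x : R := Num.sqrt (\sum_(i < n) x 0 i ^+ 2).

Definition eball x (r : R) : set 'rV[R]_n := [set y | enorm (y - x) < r].

Definition boundary A : set 'rV[R]_n := closure A `\` interior A.

(* Supremum of the lengths of inscribed polygons over the subdivisions
   0 < s_0 < ... < s_m = 1 of the unit interval. *)
Definition curve_length (gamma : R -> 'rV[R]_n) : \bar R :=
  ereal_sup [set (\sum_(0 <= k < size s)
      enorm (gamma (nth 1 (0 :: s) k.+1) - gamma (nth 1 (0 :: s) k)))%:E
    | s in itv_partition 0 1].

Definition lipschitz_paths Omega x y : set (R -> 'rV[R]_n) :=
  [set gamma | [/\ [lipschitz (gamma : R^o -> 'rV[R]_n) t | t in `[0, 1]],
                   (forall t, t \in `[0, 1] -> closure Omega (gamma t)),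
                   gamma 0 = x & gamma 1 = y]].

(* +oo when no Lipschitz path in the closure joins x to y. *)
Definition path_dist Omega x y : \bar R :=
  ereal_inf [set curve_length gamma | gamma in lipschitz_paths Omega x y].

Definition closed_path_ball Omega x (r : R) : set 'rV[R]_n :=
  [set y | closure Omega y /\ (path_dist Omega x y <= r%:E)%E].

(* Only used for y in closed_path_ball Omega x eps, where path_dist is finite. *)
Definition rho Omega (eps : R) x y : R :=
  if `[< Omega x /\ Omega y >] then Num.max (fine (path_dist Omega x y)) eps
  else fine (path_dist Omega x y).

(* The suprema are finite when u is bounded on the closure of Omega and x lies
   in the open set Omega, the only case in which they are used. *)
Definition slope_up Omega (eps : R) u x : R :=
  sup [set (u y - u x) / rho Omega eps x y
      | y in closed_path_ball Omega x eps].

Definition slope_down Omega (eps : R) u x : R :=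
  sup [set (u x - u y) / rho Omega eps x y
      | y in closed_path_ball Omega x eps].

Definition inf_laplacian Omega (eps : R) u x : R :=
  eps^-1 * (slope_up Omega eps u x - slope_down Omega eps u x).

Definition box (a b : 'rV[R]_n) : set 'rV[R]_n :=
  [set x | forall i, a 0 i <= x 0 i <= b 0 i].

Definition box_volume (a b : 'rV[R]_n) : R :=
  \prod_(i < n) Num.max 0 (b 0 i - a 0 i).

(* n-dimensional Lebesgue outer measure; its null sets are exactly the
   Lebesgue-negligible sets. *)
Definition lebesgue_outer A : \bar R :=
  ereal_inf [set (\sum_(0 <= k <oo) (box_volume (B k).1 (B k).2)%:E)%E
    | B in [set B : nat -> 'rV[R]_n * 'rV[R]_n
           | A `<=` \bigcup_k box (B k).1 (B k).2]].

(* Essential supremum of `|f| over A with respect to Lebesgue measure. *)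
Definition Linfty_norm A f : \bar R :=
  ereal_inf [set M : \bar R | (0 <= M)%E /\
    lebesgue_outer (A `&` [set x | (M < `|f x|%:E)%E]) = 0%E].

(* Functions on the closure of Omega, on its boundary, or on Omega are
   represented by total functions whose other values are irrelevant. *)
Definition bounded_solution Omega (eps : R) f g u : Prop :=
  [/\ [bounded u x | x in closure Omega],
      forall x, Omega x -> - inf_laplacian Omega eps u x = f x
    & forall x, boundary Omega x -> u x = g x].

End Defs.

(* Main.v *)
Require Import Defs.
From mathcomp Require Import all_boot all_order all_algebra.
From mathcomp Require Import all_classical all_reals all_analysis.
From mathcomp Require Import measurable_realfun ring lra.

Set Implicit Arguments.
Unset Strict Implicit.
Unset Printing Implicit Defensive.

Import Order.TTheory GRing.Theory Num.Theory.
Import numFieldNormedType.Exports.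

Local Open Scope classical_set_scope.
Local Open Scope ring_scope.

(** Write [S+ u x] and [S- u x] for the two suprema. In a convex domain the path
    distance is Euclidean ([path_distE]), so that the equation reads
    [S- u - S+ u = eps * f], where the step from [x] to [y] has length [eps] if
    [y] is interior and [|y - x|] if [y] is on the boundary. Moreover a bound on
    the essential supremum of a continuous [f] is a pointwise bound
    ([Linfty_norm_pointwise]).

    Existence holds as soon as [|f| <= 1], by Perron's method ([perron]): the
    pointwise supremum of the bounded subsolutions is a solution, because
    otherwise it could be raised at a single point. A quadratic function of one
    coordinate, shifted far below [g] in the interior, is a strict subsolution
    ([barrier]); it starts the method and bounds all solutions.

    Uniqueness rests on a walk. Let [u], [v] be solutions and suppose that
    [u - v] has the supremum [M > 0]. Where [u - v] is nearly [M], both slopes of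
    [u] and [v] nearly agree, and an endpoint [y] which nearly attains [S+ u x] is
    again such a point, hence interior, with [u y >= u x + eps * S+ u x] up to a
    small error ([ascent_step]). If [S+ u] is bounded below by a positive constant,
    repeating this contradicts the boundedness of [u] ([ascent_comparison]). It
    remains to bound [S+ u] below for all solutions with small [f].

    Solutions with small [f] are uniformly close to the solution [u0] for [f = 0]
    ([stability]): if the walk cannot go on, the slope is tiny, both functions are
    almost constant near [x], the whole ball around [x] consists of near-maxima,
    and so does a chain of points leading to the boundary, where [u - v <= 0].
    The same lemma compares the two semicontinuous envelopes of [u0], so [u0] is
    continuous ([solution_continuous]). By compactness it is now enough that [u0]
    is not constant on any ball of radius [eps] ([nowhere_flat]).

    Suppose that [u0] is constant around [x]. If it equals [k] on a ball centered
    at [x] and contained in the domain, it equals [k] at all points within [eps]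
    of this ball ([flat_step]). Indeed, let [Q] be the maximal slope seen from the
    ball, attained at [z], and look from the innermost possible point [y]; as the
    two slopes agree at [y], the slope [Q] is also attained downwards, at some
    [z']. No point of the ball closer to [x] sees a slope [Q], which forces
    [z'], like [z], onto the ray from [x] through [y]: the two points coincide,
    which is absurd. So the constancy spreads until the ball meets the boundary, and [g] is
    constant near some boundary point, against the assumption. *)

(** * The Euclidean norm *)

Section EuclideanNorm.
Context {R : realType} {n : nat}.
Implicit Types (x y z : 'rV[R]_n) (a r : R) (A : set 'rV[R]_n).

Definition dotp x y : R := \sum_(i < n) x 0 i * y 0 i.

Lemma enorm_ge0 x : 0 <= enorm x.
Proof. exact: sqrtr_ge0. Qed.

Lemma enorm_sq x : enorm x ^+ 2 = dotp x x.
Proof.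
rewrite sqr_sqrtr; first by apply: eq_bigr => i _; rewrite expr2.
by apply: sumr_ge0 => i _; exact: sqr_ge0.
Qed.

Lemma enorm_sq_lin a b x y :
  enorm (a *: x + b *: y) ^+ 2 =
  a ^+ 2 * enorm x ^+ 2 + a * b * 2 * dotp x y + b ^+ 2 * enorm y ^+ 2.
Proof.
rewrite !enorm_sq /dotp !mulr_sumr -!big_split /=.
by apply: eq_bigr => i _; rewrite !mxE; ring.
Qed.

Lemma enorm_eq0 x : enorm x = 0 -> x = 0.
Proof.
move=> h; have : enorm x ^+ 2 = 0 by rewrite h expr0n.
rewrite enorm_sq => /eqP; rewrite psumr_eq0 => [|i _]; last first.
  by rewrite -expr2 sqr_ge0.
move=> /allP x0; apply/rowP => i; rewrite mxE.
by have := x0 i (mem_index_enum _); rewrite -expr2 sqrf_eq0 => /eqP.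
Qed.

Lemma enormZ a x : enorm (a *: x) = `|a| * enorm x.
Proof.
apply/eqP; rewrite -(@eqrXn2 _ 2) ?enorm_ge0 ?mulr_ge0 ?enorm_ge0//.
have -> : a *: x = a *: x + 0 *: x by rewrite scale0r addr0.
by rewrite enorm_sq_lin exprMn real_normK ?num_real//; apply/eqP; ring.
Qed.

Lemma enormN x : enorm (- x) = enorm x.
Proof. by rewrite -scaleN1r enormZ normrN1 mul1r. Qed.

Lemma enorm0 : enorm (0 : 'rV[R]_n) = 0.
Proof. by rewrite -(scale0r 0) enormZ normr0 mul0r. Qed.

Lemma enormBC x y : enorm (x - y) = enorm (y - x).
Proof. by rewrite -opprB enormN. Qed.

Lemma enorm_gt0 x : x != 0 -> 0 < enorm x.
Proof.
move=> x0; rewrite lt_neqAle enorm_ge0 andbT eq_sym.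
by apply: contra x0 => /eqP /enorm_eq0 ->.
Qed.

(** This identity yields both the Cauchy-Schwarz inequality and its equality
    case, the strict convexity of the norm. *)
Lemma lagrange_id x y :
  enorm (enorm y *: x + (- enorm x) *: y) ^+ 2 =
  2 * (enorm x * enorm y) * (enorm x * enorm y - dotp x y).
Proof. by rewrite enorm_sq_lin; ring. Qed.

Lemma dotp_le x y : dotp x y <= enorm x * enorm y.
Proof.
have [->|x0] := eqVneq x 0.
  by rewrite enorm0 mul0r /dotp big1// => i _; rewrite mxE mul0r.
have [->|y0] := eqVneq y 0.
  by rewrite enorm0 mulr0 /dotp big1// => i _; rewrite mxE mulr0.
rewrite -subr_ge0 -(@pmulr_rge0 _ (2 * (enorm x * enorm y))).
  by rewrite -lagrange_id sqr_ge0.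
by rewrite !mulr_gt0 ?enorm_gt0.
Qed.

Lemma enorm_sqD x y :
  enorm (x + y) ^+ 2 = enorm x ^+ 2 + 2 * dotp x y + enorm y ^+ 2.
Proof. by rewrite -[x in LHS]scale1r -[y in LHS]scale1r enorm_sq_lin; ring. Qed.

Lemma enormD x y : enorm (x + y) <= enorm x + enorm y.
Proof.
rewrite -(@ler_pXn2r _ 2) ?nnegrE ?addr_ge0 ?enorm_ge0//.
by rewrite enorm_sqD; have := dotp_le x y; lra.
Qed.

Lemma enormD_eq x y : enorm (x + y) = enorm x + enorm y ->
  enorm y *: x = enorm x *: y.
Proof.
move=> h; have hd : dotp x y = enorm x * enorm y.
  have := enorm_sqD x y; rewrite h; lra.
apply/eqP; rewrite -subr_eq0 -scaleNr; apply/eqP/enorm_eq0/eqP.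
by rewrite -sqrf_eq0 lagrange_id hd subrr mulr0.
Qed.

Lemma enorm_tri x y z : enorm (z - x) <= enorm (y - x) + enorm (z - y).
Proof.
have -> : z - x = (y - x) + (z - y) by rewrite [RHS]addrC addrA subrK.
exact: enormD.
Qed.

Lemma coord_le_enorm x i : `|x 0 i| <= enorm x.
Proof.
rewrite -(@ler_pXn2r _ 2) ?nnegrE ?enorm_ge0// real_normK ?num_real//.
rewrite enorm_sq /dotp (bigD1 i)//= -expr2 lerDl.
by apply: sumr_ge0 => j _; rewrite -expr2 sqr_ge0.
Qed.

Lemma norm_le_enorm x : `|x| <= enorm x.
Proof.
rewrite [leLHS]/Num.norm /= mx_normrE; apply/bigmax_leP; split.
  exact: enorm_ge0.
by move=> [i j] _ /=; rewrite ord1 coord_le_enorm.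
Qed.

Lemma coord_le_norm x i : `|x 0 i| <= `|x|.
Proof.
rewrite [leRHS]/Num.norm /= mx_normrE.
exact: (le_bigmax _ (fun ij : 'I_1 * 'I_n => `|x ij.1 ij.2|) (0, i)).
Qed.

Lemma enorm_le_norm x : enorm x <= n%:R * `|x|.
Proof.
have n1 : n%:R <= (n%:R : R) ^+ 2.
  by rewrite -natrX ler_nat -mulnn; case: n => // m; rewrite leq_pmulr.
rewrite -(@ler_pXn2r _ 2) ?nnegrE ?enorm_ge0 ?mulr_ge0//.
rewrite enorm_sq exprMn; apply: (@le_trans _ _ (n%:R * `|x| ^+ 2)).
  rewrite -[n in n%:R]card_ord mulr_natl -sumr_const; apply: ler_sum => i _.
  rewrite -expr2 -real_normK ?num_real// ler_pXn2r ?nnegrE//.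
  exact: coord_le_norm.
by rewrite ler_wpM2r ?sqr_ge0.
Qed.

End EuclideanNorm.

(** * Compactness in Euclidean space *)

Section EuclideanTopology.
Context {R : realType} {n : nat}.
Implicit Types (x y z : 'rV[R]_n) (a r : R) (A K : set 'rV[R]_n).

Lemma nbhs_enormP x A :
  nbhs x A <-> exists2 r, 0 < r & forall y, enorm (y - x) < r -> A y.
Proof.
split=> [/nbhs_ballP[r /= r0 rA]|[r r0 rA]].
  exists r => // y yr; apply: rA; rewrite -ball_normE /= distrC.
  exact: le_lt_trans (norm_le_enorm _) yr.
apply/nbhs_ballP; exists (r / n.+1%:R) => /=; first by rewrite divr_gt0.
move=> y; rewrite -ball_normE /= => yr; apply: rA; rewrite distrC in yr.
apply: le_lt_trans (enorm_le_norm _) _.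
have n0 : 0 < n.+1%:R :> R by [].
move: yr; rewrite ltr_pdivlMr// => yr; apply: le_lt_trans yr.
by rewrite mulrC ler_wpM2l// ler_nat.
Qed.

Lemma closure_enormP A x : closure A x <->
  forall r, 0 < r -> exists2 y, A y & enorm (y - x) < r.
Proof.
split=> [cA r r0|cA B /nbhs_enormP[r r0 rB]].
  have /cA[y [Ay yr]] : nbhs x [set y | enorm (y - x) < r].
    by apply/nbhs_enormP; exists r.
  by exists y.
by have [y Ay yr] := cA r r0; exists y; split => //; exact: rB.
Qed.

Lemma open_enorm A x : open A -> A x ->
  exists2 r, 0 < r & forall y, enorm (y - x) < r -> A y.
Proof. by move=> oA Ax; apply/nbhs_enormP; exact: open_nbhs_nbhs. Qed.

Lemma closed_enorm_ball x r : closed [set y | enorm (y - x) <= r].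
Proof.
move=> y /closure_enormP cy /=; apply/ler_addgt0Pr => e e0.
have [z /= zr zy] := cy e e0.
have := enorm_tri x z y; rewrite (enormBC y z); lra.
Qed.

(** Compactness in quantitative form: the radius up to which a property is
    known locally and the parameter for which it is known are the same [r], so
    that neighbourhoods and bounds are made uniform at once. *)
Lemma compact_uniform K (P : R -> 'rV[R]_n -> Prop) : compact K ->
  (forall r r' x, 0 < r' -> r' <= r -> P r x -> P r' x) ->
  (forall x, K x -> exists2 r, 0 < r &
     forall y, K y -> enorm (y - x) < r -> P r y) ->
  exists2 r, 0 < r & forall x, K x -> P r x.
Proof.
move=> /compact_near_coveringP /near_covering_withinP cK Pmono Ploc.
have h : \forall r \near 0^'+, K `<=` P r.
  apply: cK => x Kx; have [r r0 rP] := Ploc x Kx.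
  exists ([set y | enorm (y - x) < r], [set s : R | 0 < s /\ s <= r]) => /=.
    split; first by apply/nbhs_enormP; exists r.
    by apply: filterI; [exact: nbhs_right_gt|exact: nbhs_right_le].
  by move=> [y s] /= [yr [s0 sr]] Ky; apply: Pmono s0 sr _; exact: rP.
have h0 : \forall r \near 0^'+, (0 : R) < r by exact: nbhs_right_gt.
have [r [rP r0]] := @filter_ex _ _ (at_right_proper_filter (0 : R)) _ (filterI h h0).
by exists r.
Qed.

(** Upper semicontinuity is what the maximal slope of a continuous function has:
    the step length jumps down at the boundary. *)
Lemma usc_max K (h : 'rV[R]_n -> R) : compact K -> K !=set0 ->
  (forall x e, K x -> 0 < e -> exists2 r, 0 < r &
     forall y, K y -> enorm (y - x) < r -> h y < h x + e) ->
  exists2 x, K x & forall y, K y -> h y <= h x.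
Proof.
move=> cK [k Kk] hK.
have [r r0 hr] : exists2 r, 0 < r & forall x, K x -> h x <= r^-1.
  apply: (compact_uniform (P := fun r x => h x <= r^-1) cK).
    move=> r r' x r'0 r'r hx; apply: le_trans hx _.
    by rewrite lef_pV2// posrE (lt_le_trans r'0).
  move=> x Kx; have [r r0 hr] := hK x 1 Kx ltr01.
  pose s := Num.min r (`|h x| + 1)^-1.
  have h1 : 0 < `|h x| + 1 by rewrite ltr_pwDr.
  have s0 : 0 < s by rewrite lt_min r0 invr_gt0.
  exists s => // y Ky; rewrite lt_min => /andP[yr _].
  apply: le_trans (ltW (hr y Ky yr)) _.
  have : s <= (`|h x| + 1)^-1 by rewrite ge_min lexx orbT.
  rewrite -[leLHS]invrK lef_pV2 ?posrE ?invr_gt0//.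
  by apply: le_trans; rewrite lerD2r ler_norm.
have hS : has_sup [set h x | x in K].
  by split; [exists (h k), k | exists r^-1 => _ [x Kx <-]; exact: hr].
apply: contrapT => nmax.
have hlt x : K x -> h x < sup [set h x | x in K].
  move=> Kx; rewrite ltNge; apply/negP => le; apply: nmax; exists x => // y Ky.
  by apply: le_trans le; apply: ub_le_sup; [exact: hS.2|exists y].
have [d d0 hd] : exists2 d, 0 < d &
    forall x, K x -> h x <= sup [set h x | x in K] - d.
  apply: (compact_uniform (P := fun r x => h x <= _ - r) cK).
    by move=> s s' x _ ss' /le_trans; apply; rewrite lerD2l lerN2.
  move=> x Kx; set M := sup _ in hlt *.
  have e0 : 0 < (M - h x) / 2 by rewrite divr_gt0// subr_gt0 hlt.
  have [s s0 hs] := hK x _ Kx e0.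
  exists (Num.min s ((M - h x) / 2)); first by rewrite lt_min s0.
  move=> y Ky; rewrite lt_min => /andP[ys _].
  have := hs y Ky ys.
  have : Num.min s ((M - h x) / 2) <= (M - h x) / 2 by rewrite ge_min lexx orbT.
  lra.
have : sup [set h x | x in K] <= sup [set h x | x in K] - d.
  by apply: ge_sup; [exists (h k), k|move=> _ [x Kx <-]; exact: hd].
lra.
Qed.

End EuclideanTopology.

(** * Convex domains and the path distance *)

Section ConvexDomain.
Context {R : realType} {n : nat}.
Implicit Types (x y z p : 'rV[R]_n) (t r : R) (A Omega : set 'rV[R]_n).

Lemma convex_segment A x y t : convex_set A -> A x -> A y -> 0 <= t <= 1 ->
  A (x + t *: (y - x)).
Proof.
move=> cA Ax Ay /andP[t0 t1].
have := cA y x (Itv01 t0 t1) (mem_set Ay) (mem_set Ax).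
rewrite inE /conv /= /unstable.onem scalerBl scale1r scalerBr.
by rewrite addrC addrAC -addrA.
Qed.

(** Shift [x] slightly so that the segment hits a point of the set itself. *)
Lemma convex_segment_closure Omega x p t : open Omega -> convex_set Omega ->
  Omega x -> closure Omega p -> 0 <= t < 1 -> Omega (x + t *: (p - x)).
Proof.
move=> oO cO Ox cp /andP[t0 t1].
have [r r0 rO] := open_enorm oO Ox.
have s0 : 0 < 1 - t by lra.
have e0 : 0 < r * (1 - t) / 2 by rewrite !mulr_gt0 ?invr_gt0.
have /closure_enormP /(_ _ e0)[q Oq qp] := cp.
pose x' := x + (t / (1 - t)) *: (p - q).
have Ox' : Omega x'.
  apply: rO; rewrite /x' addrC addKr enormZ enormBC ger0_norm ?divr_ge0//; last lra.
  rewrite mulrAC ltr_pdivrMr//.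
  apply: (@le_lt_trans _ _ (enorm (q - p))); last nra.
  by rewrite ler_piMl ?enorm_ge0// ltW.
have -> : x + t *: (p - x) = x' + t *: (q - x').
  rewrite /x'; set v := p - q; have -> : q = p - v by rewrite opprB addrC subrK.
  apply/rowP => i; rewrite !mxE; field; lra.
by apply: convex_segment => //; rewrite t0 ltW.
Qed.

Lemma convex_closure A : convex_set A ->
  forall x y t, closure A x -> closure A y -> 0 <= t <= 1 ->
  closure A (x + t *: (y - x)).
Proof.
move=> cA x y t cx cy /[dup] t01 /andP[t0 t1]; apply/closure_enormP => r r0.
have r20 : 0 < r / 2 by lra.
have /closure_enormP/(_ _ r20)[x' Ax' x'x] := cx.
have /closure_enormP/(_ _ r20)[y' Ay' y'y] := cy.
exists (x' + t *: (y' - x')); first exact: convex_segment.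
have -> : x' + t *: (y' - x') - (x + t *: (y - x)) =
   (1 - t) *: (x' - x) + t *: (y' - y).
  by apply/rowP => i; rewrite !mxE; ring.
apply: le_lt_trans (enormD _ _) _; rewrite !enormZ !ger0_norm//; last lra.
have := enorm_ge0 (x' - x); have := enorm_ge0 (y' - y); nra.
Qed.

Lemma boundary_openP Omega x : open Omega ->
  boundary Omega x <-> closure Omega x /\ ~ Omega x.
Proof. by move=> oO; rewrite /boundary; have /interior_id -> := oO. Qed.

(** The exit time is the supremum of the times spent in the set; it need not be
    the first time outside, but the point is in the closure and not inside. *)
Lemma exit_point Omega x w : open Omega -> Omega x -> ~ Omega w ->
  exists2 t, 0 < t <= 1 & boundary Omega (x + t *: (w - x)).
Proof.
move=> oO Ox Ow.
pose S := [set t : R | 0 <= t <= 1 /\ Omega (x + t *: (w - x))].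
have S0 : S 0 by rewrite /S /= scale0r addr0 lexx ler01.
have hS : has_sup S by split; [exists 0|exists 1 => t [/andP[]]].
set s := sup S; have s0 : 0 <= s by apply: ub_le_sup => //; exact: hS.2.
have s1 : s <= 1 by apply: ge_sup; [exists 0|move=> t [/andP[]]].
set p := x + s *: (w - x).
have pd t : x + t *: (w - x) - p = (t - s) *: (w - x).
  by rewrite /p; apply/rowP => i; rewrite !mxE; ring.
have w0 : 0 < enorm (w - x) + 1 by have := enorm_ge0 (w - x); lra.
have cp : closure Omega p.
  apply/closure_enormP => r r0.
  have e0 : 0 < r / (enorm (w - x) + 1) by rewrite divr_gt0.
  have [t [t01 Ot] st] := sup_adherent e0 hS.
  exists (x + t *: (w - x)) => //; rewrite pd enormZ.
  have ts : t <= s by apply: ub_le_sup => //; exact: hS.2.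
  rewrite ler0_norm ?subr_le0// opprB.
  have : s - t < r / (enorm (w - x) + 1) by rewrite ltrBlDr -ltrBlDl.
  rewrite ltr_pdivlMr//; have := enorm_ge0 (w - x); nra.
have Op : ~ Omega p.
  move=> Op; have [r r0 rO] := open_enorm oO Op.
  have [s1'|s1'] := ltP s 1; last first.
    have se : s = 1 by apply/le_anti/andP.
    by apply: Ow; move: Op; rewrite /p se scale1r addrC subrK.
  pose d := Num.min (1 - s) (r / (enorm (w - x) + 1) / 2).
  have d0 : 0 < d by rewrite lt_min subr_gt0 s1' !divr_gt0.
  have : S (s + d).
    split; first by rewrite addr_ge0 ?(ltW d0)//= -lerBrDl ge_min lexx.
    apply: rO; rewrite pd enormZ addrAC subrr add0r ger0_norm ?(ltW d0)//.
    have : d <= r / (enorm (w - x) + 1) / 2 by rewrite ge_min lexx orbT.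
    have : r / (enorm (w - x) + 1) * (enorm (w - x) + 1) = r by rewrite divfK ?gt_eqF.
    set q := r / _; have := enorm_ge0 (w - x); nra.
  move=> /(ub_le_sup hS.2); rewrite -/s; lra.
exists s; last by apply/boundary_openP.
rewrite s1 andbT lt_neqAle s0 andbT; apply/negP => /eqP s0'.
by apply: Op; rewrite /p -s0' scale0r addr0.
Qed.

(** The one-piece subdivision bounds the length of any path from below by the
    Euclidean distance; the segment, which stays in the convex closure, has all
    its inscribed polygons of exactly this length. *)
Lemma path_distE Omega x y : convex_set Omega ->
  closure Omega x -> closure Omega y ->
  path_dist Omega x y = (enorm (y - x))%:E.
Proof.
move=> cO cx cy; apply/eqP; rewrite eq_le; apply/andP; split; last first.
  apply/ereal_infP => _ [gamma [_ _ g0 g1] <-].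
  apply: ereal_sup_ubound; exists [:: 1].
    by split; rewrite /= ?eqxx// ltr01.
  by rewrite /= big_nat1 /= g0 g1.
pose gamma (t : R) := x + t *: (y - x).
have gB s t : gamma s - gamma t = (s - t) *: (y - x).
  by rewrite /gamma; apply/rowP => i; rewrite !mxE; ring.
apply: ge_ereal_inf; exists (curve_length gamma).
  exists gamma => //; split.
  - exists `|y - x|; split; first exact: num_real.
    move=> M /ltW hM [s t] /= _; rewrite gB normrZ mulrC.
    by rewrite ler_wpM2r.
  - by move=> t; rewrite in_itv /= => t01; exact: convex_closure.
  - by rewrite /gamma scale0r addr0.
  - by rewrite /gamma scale1r addrC subrK.
apply/ereal_supP => _ [s hs <-]; rewrite lee_fin.
rewrite (eq_big_nat _ _ (F2 := fun k =>
    (nth 1 (0 :: s) k.+1 - nth 1 (0 :: s) k) * enorm (y - x))); last first.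
  move=> k /andP[_ ks]; rewrite gB enormZ ger0_norm// subr_ge0.
  have := @nondecreasing_fun_itv_partition _ _ 0 1 id s _ hs k ks.
  by apply => u v _ _.
rewrite -mulr_suml telescope_sumr// (itv_partition_nth_size _ hs) /= subr0.
by rewrite mul1r.
Qed.

End ConvexDomain.

(** * Essential bounds of continuous functions *)

Section BoxVolume.
Context {R : realType}.

Definition row_tail n (a : 'rV[R]_n.+1) : 'rV[R]_n := \row_j a 0 (lift ord0 j).

Lemma box_volume_recl n (a b : 'rV[R]_n.+1) :
  box_volume a b =
  Num.max 0 (b 0 ord0 - a 0 ord0) * box_volume (row_tail a) (row_tail b).
Proof.
rewrite /box_volume big_ord_recl; congr (_ * _).
by apply: eq_bigr => i _; rewrite !mxE.
Qed.

Lemma box_volume_ge0 n (a b : 'rV[R]_n) : 0 <= box_volume a b.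
Proof. by apply: prodr_ge0 => i _; rewrite le_max lexx. Qed.

(** Countable boxes covering a box have at least its volume, by slicing along
    the first coordinate and integrating the lower-dimensional inequality. The
    boolean family [D] selects the boxes met by a slice; it cannot be replaced
    by empty boxes, as dimension [0] has none. *)
Lemma box_volume_cover n (a b : 'rV[R]_n) (D : nat -> bool)
    (B : nat -> 'rV[R]_n * 'rV[R]_n) :
  (forall i, a 0 i <= b 0 i) ->
  (forall x, box a b x -> exists2 k, D k & box (B k).1 (B k).2 x) ->
  ((box_volume a b)%:E <=
   \sum_(0 <= k <oo) ((D k)%:R * box_volume (B k).1 (B k).2)%:E)%E.
Proof.
have t0 m (C : nat -> 'rV[R]_m * 'rV[R]_m) (E : nat -> bool) k :
    (0 <= ((E k)%:R * box_volume (C k).1 (C k).2)%:E)%E.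
  by rewrite lee_fin mulr_ge0 ?box_volume_ge0.
elim: n a b D B => [|n IH] a b D B ab cov.
  have [k Dk _] : exists2 k, D k & box (B k).1 (B k).2 a by apply: cov => -[].
  apply: le_trans (nneseries_lim_ge k.+1 _) => [|//].
  rewrite big_nat_recr//= Dk mul1r /box_volume !big_ord0.
  rewrite leeDr//; apply: sume_ge0 => i _; exact: t0.
pose I k : set R := `[(B k).1 0 ord0, (B k).2 0 ord0]%classic.
pose J : set R := `[a 0 ord0, b 0 ord0]%classic.
pose w k := (D k)%:R * box_volume (row_tail (B k).1) (row_tail (B k).2).
have w0 k : 0 <= w k by rewrite mulr_ge0 ?box_volume_ge0.
have mI k : measurable (I k) by exact: measurable_itv.
have mJ : measurable J by exact: measurable_itv.
have lenE (c d : R) : (lebesgue_measure (`[c, d]%classic : set R) =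
    (Num.max 0 (d - c))%:E)%E.
  rewrite lebesgue_measure_itv /= lte_fin; case: ltP => cd.
    by rewrite -EFinB max_r// subr_ge0 ltW.
  by rewrite max_l// subr_le0.
pose h k (t : R) : \bar R := ((w k)%:E * (\1_(I k) t)%:E)%E.
pose g (t : R) : \bar R := (\sum_(0 <= k <oo) h k t)%E.
have slice t : J t ->
    ((box_volume (row_tail a) (row_tail b))%:E <= g t)%E.
  rewrite /J /= in_itv /= => Jt.
  pose Dt k := D k && (t \in I k).
  have := IH (row_tail a) (row_tail b) Dt
    (fun k => (row_tail (B k).1, row_tail (B k).2)).
  have -> : g t = (\sum_(0 <= k <oo) ((Dt k)%:R *
      box_volume (row_tail (B k).1) (row_tail (B k).2))%:E)%E.
    apply: eq_eseriesr => k _; rewrite /h -EFinM indicE /w /Dt; congr (_%:E).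
    by case: (D k); case: (t \in I k); rewrite /= ?(mul0r, mul1r, mulr1, mulr0).
  apply=> [i|x xab]; first by rewrite !mxE; exact: ab.
  pose x' : 'rV[R]_n.+1 := \row_i oapp (x 0) t (unlift ord0 i).
  have x'S j : x' 0 (lift ord0 j) = x 0 j by rewrite mxE liftK.
  have x'0 : x' 0 ord0 = t by rewrite mxE unlift_none.
  have [|k Dk xk] := cov x'.
    move=> i; case: (unliftP ord0 i) => [j|] ->; last by rewrite x'0.
    by rewrite x'S; have := xab j; rewrite !mxE.
  exists k.
    rewrite /Dt Dk /=; apply/mem_set; rewrite /I /= in_itv /=.
    by rewrite -x'0; exact: xk.
  by move=> j /=; have := xk (lift ord0 j); rewrite x'S !mxE.
have mw k : measurable_fun J (h k).
  apply: measurable_funeM; apply/measurable_EFinP.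
  exact: measurable_indic.
have w1 k t : (0 <= h k t)%E.
  by rewrite /h -EFinM lee_fin mulr_ge0// indicE.
have gE : (\int[lebesgue_measure]_(t in J) g t <=
    \sum_(0 <= k <oo) ((D k)%:R * box_volume (B k).1 (B k).2)%:E)%E.
  rewrite /g integral_nneseries//; apply: lee_nneseries => k _.
    by move=> _; apply: integral_ge0 => t _.
  have mind : measurable_fun J (fun t : R => (\1_(I k) t : R)%:E).
    by apply/measurable_EFinP; exact: measurable_indic.
  rewrite /h (ge0_integralZl lebesgue_measure mJ mind)//; last first.
    by rewrite lee_fin.
  rewrite (integral_indic lebesgue_measure mJ (mI k)).
  rewrite (box_volume_recl (B k).1 (B k).2) mulrCA mulrC.
  rewrite (EFinM (_ * _) (Num.max _ _)) -/(w k).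
  apply: lee_wpmul2l; first by rewrite lee_fin.
  have mIJ : measurable (I k `&` J) by exact: measurableI.
  rewrite -lenE; apply: le_measure.
  - by rewrite inE.
  - by rewrite inE; exact: mI.
  - exact: subIsetl.
apply: le_trans gE.
have -> : (box_volume a b)%:E =
   (\int[lebesgue_measure]_(t in J)
     cst (box_volume (row_tail a) (row_tail b))%:E t)%E.
  rewrite (integral_cst lebesgue_measure mJ) (box_volume_recl a b) mulrC EFinM.
  by congr (_ * _)%E; rewrite -lenE.
have mg : measurable_fun J g.
  have -> : g = fun t => (\sum_(0 <= k <oo | k \in xpredT) h k t)%E.
    by apply/funext => t; apply: eq_eseriesl.
  by apply: ge0_emeasurable_sum.
apply: ge0_le_integral => //.
by move=> t _; rewrite lee_fin box_volume_ge0.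
Qed.

(** A neighbourhood contains a box, whose volume no countable cover can beat. *)
Lemma nbhs_lebesgue_outer n (A : set 'rV[R]_n) (x : 'rV[R]_n) : nbhs x A ->
  lebesgue_outer A <> 0%E.
Proof.
move=> /nbhs_ballP[e /= e0 eA].
pose a : 'rV[R]_n := \row_i (x 0 i - e / 2).
pose b : 'rV[R]_n := \row_i (x 0 i + e / 2).
have ab i : a 0 i <= b 0 i by rewrite !mxE; lra.
have sub y : box a b y -> A y.
  move=> yab; apply: eA; split => // i j; rewrite ord1.
  by have := yab j; rewrite !mxE -ball_normE /= ltr_norml => /andP[]; lra.
have vol0 : 0 < box_volume a b.
  by apply: prodr_gt0 => i _; rewrite !mxE lt_max; apply/orP; right; lra.
have : ((box_volume a b)%:E <= lebesgue_outer A)%E.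
  apply/ereal_infP => _ [B /= cov <-].
  have := @box_volume_cover n a b xpredT B ab.
  rewrite (eq_eseriesr (g := fun k => (box_volume (B k).1 (B k).2)%:E)); last first.
    by move=> k _; rewrite mul1r.
  by apply => y /sub /cov[k _ yk]; exists k.
by move=> + h; rewrite h lee_fin leNgt vol0.
Qed.

Lemma Linfty_norm_pointwise n (Omega : set 'rV[R]_n) (f : 'rV[R]_n -> R) d :
  open Omega -> {within Omega, continuous f} ->
  (Linfty_norm Omega f <= d%:E)%E -> forall x, Omega x -> `|f x| <= d.
Proof.
move=> oO cf fd x Ox; rewrite leNgt; apply/negP => dx.
have : (Linfty_norm Omega f < `|f x|%:E)%E by apply: le_lt_trans fd _.
move=> /ereal_inf_lt[M [M0 null] Mx]; apply: nbhs_lebesgue_outer null.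
have cfx : {for x, continuous f}.
  by move: cf; rewrite continuous_open_subspace// => /(_ x); apply; exact: mem_set.
have : nbhs (f x) [set r : R | (M < `|r|%:E)%E].
  case: M M0 Mx => [M| |] // _; rewrite lte_fin => Mx.
  have e0 : 0 < `|f x| - M by rewrite subr_gt0.
  apply/nbhs_ballP; exists (`|f x| - M) => //= r; rewrite -ball_normE /= lte_fin.
  by have := lerB_dist (f x) r; lra.
move=> /cfx /= h; apply: filterI; last exact: h.
exact: open_nbhs_nbhs.
Qed.

End BoxVolume.

(** * Slopes and the comparison principle *)

Section DiscreteEquation.
Context {R : realType} {n : nat} {Omega : set 'rV[R]_n} {eps : R}.
Hypothesis oO : open Omega.
Hypothesis cO : convex_set Omega.
Hypothesis eps0 : 0 < eps.
Implicit Types (x y z p : 'rV[R]_n) (u v w : 'rV[R]_n -> R).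
Implicit Types (a c e k r t C G Q : R).

Local Notation cl := (closure Omega).

(** The topological boundary of an open set, see [boundary_openP]. *)
Definition bdry x := cl x /\ ~ Omega x.

Definition nbr x y := cl y /\ enorm (y - x) <= eps.

(** The value of [rho] on steps of length at most [eps], once the path distance
    is known to be Euclidean. *)
Definition step_len x y : R := if `[< Omega y >] then eps else enorm (y - x).

(** The upward slope; the downward slope of [u] is [slope (\- u)], which halves
    the theory. *)
Definition slope u x : R := sup [set (u y - u x) / step_len x y | y in nbr x].

Definition bounded_cl u := exists C, forall x, cl x -> `|u x| <= C.

Definition subsol (k : R) u := forall x, Omega x -> slope (\- u) x - slope u x <= k.

Lemma subsolW k k' u : k <= k' -> subsol k u -> subsol k' u.
Proof. by move=> kk' su x Ox; apply: le_trans kk'; exact: su. Qed.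

Lemma Omega_cl x : Omega x -> cl x.
Proof. exact: subset_closure. Qed.

Lemma step_len_in x y : Omega y -> step_len x y = eps.
Proof. by rewrite /step_len; case: asboolP. Qed.

Lemma step_len_bd x y : ~ Omega y -> step_len x y = enorm (y - x).
Proof. by rewrite /step_len; case: asboolP. Qed.

Lemma step_len_le x y : nbr x y -> step_len x y <= eps.
Proof. by rewrite /step_len; case: asboolP => // _ []. Qed.

Lemma step_len_lb x : Omega x ->
  exists2 r, 0 < r & forall y, r <= step_len x y.
Proof.
move=> Ox; have [r r0 rO] := open_enorm oO Ox.
exists (Num.min r eps); first by rewrite lt_min r0.
move=> y; have [Oy|Oy] := pselect (Omega y).
  by rewrite step_len_in// ge_min lexx orbT.
rewrite step_len_bd// ge_min leNgt; apply/orP; left; apply/negP.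
by move=> /rO.
Qed.

Lemma step_len_gt0 x y : Omega x -> 0 < step_len x y.
Proof. by move=> /step_len_lb[r r0 /(_ y)]; exact: lt_le_trans. Qed.

Lemma nbr_refl x : Omega x -> nbr x x.
Proof. by move=> /Omega_cl Ox; split => //; rewrite subrr enorm0 ltW. Qed.

Lemma nbr_sym x y : Omega x -> nbr x y -> nbr y x.
Proof. by move=> /Omega_cl Ox [_ xy]; split => //; rewrite enormBC. Qed.

Lemma bounded_clN u : bounded_cl u -> bounded_cl (\- u).
Proof. by move=> [C uC]; exists C => x cx /=; rewrite normrN uC. Qed.

Lemma opp_funK u : \- (\- u) = u.
Proof. by apply/funext => x /=; rewrite opprK. Qed.

Lemma slope_has_sup u x : Omega x -> bounded_cl u ->
  has_sup [set (u y - u x) / step_len x y | y in nbr x].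
Proof.
move=> Ox [C uC]; split.
  by exists ((u x - u x) / step_len x x), x => //; exact: nbr_refl.
have [r r0 rl] := step_len_lb Ox.
exists ((C + C) / r) => _ [y [cy _] <-].
have sl := step_len_gt0 y Ox.
have CC : 0 <= C + C by have := uC _ cy; have := normr_ge0 (u y); lra.
apply: (@le_trans _ _ ((C + C) / step_len x y)).
  rewrite ler_wpM2r ?invr_ge0 ?(ltW sl)//.
  have /ler_normlP[? ?] := uC _ cy; have /ler_normlP[? ?] := uC _ (Omega_cl Ox); lra.
by rewrite ler_wpM2l// lef_pV2 ?posrE.
Qed.

Lemma slope_ub u x y : Omega x -> bounded_cl u -> nbr x y ->
  u y - u x <= slope u x * step_len x y.
Proof.
move=> Ox bu xy; rewrite -ler_pdivrMr ?step_len_gt0//.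
by apply: ub_le_sup; [exact: (slope_has_sup Ox bu).2|exists y].
Qed.

Lemma slope_lt u x a : Omega x -> bounded_cl u -> a < slope u x ->
  exists2 y, nbr x y & a * step_len x y < u y - u x.
Proof.
move=> Ox bu au; have d0 : 0 < slope u x - a by rewrite subr_gt0.
have [_ [y xy <-]] := sup_adherent d0 (slope_has_sup Ox bu).
rewrite -/(slope u x) opprB addrC subrK => h; exists y => //.
by rewrite -ltr_pdivlMr ?step_len_gt0.
Qed.

Lemma slope_le u x a : Omega x ->
  (forall y, nbr x y -> u y - u x <= a * step_len x y) -> slope u x <= a.
Proof.
move=> Ox ua; apply: ge_sup.
  by exists ((u x - u x) / step_len x x), x => //; exact: nbr_refl.
by move=> _ [y xy <-]; rewrite ler_pdivrMr ?step_len_gt0// ua.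
Qed.

Lemma slope_ge0 u x : Omega x -> bounded_cl u -> 0 <= slope u x.
Proof.
move=> Ox bu; have := slope_ub Ox bu (nbr_refl Ox).
by rewrite subrr pmulr_lge0// step_len_gt0.
Qed.

Lemma slopeN_ub u x y : Omega x -> bounded_cl u -> nbr x y ->
  u x - u y <= slope (\- u) x * step_len x y.
Proof.
by move=> Ox /bounded_clN bu xy; have := slope_ub Ox bu xy; rewrite /= opprK addrC.
Qed.

Lemma min_le2 (a b : R) : Num.min a b <= a /\ Num.min a b <= b.
Proof. by rewrite !ge_min !lexx orbT. Qed.

(** Near a maximum of [u - v] every interior increment of [u] is almost at most
    that of [v]. For a boundary endpoint [y] there is no error at all, since
    [u y - v y <= 0 <= u x - v x]; this matters because such steps may be short. *)
Lemma near_max_slope u v x (M eta : R) : Omega x ->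
  bounded_cl v -> (forall y, cl y -> u y - v y <= M) ->
  (forall y, bdry y -> u y <= v y) -> 0 <= eta <= M ->
  M - eta <= u x - v x -> slope u x <= slope v x + eta / eps.
Proof.
move=> Ox bv uvM uvb /andP[eta0 etaM] hx; apply: slope_le => // y xy.
have h := slope_ub Ox bv xy; have sl := step_len_gt0 y Ox.
have e0 : 0 <= eta / eps by rewrite divr_ge0// ltW.
have [Oy|Oy] := pselect (Omega y).
  rewrite step_len_in// in h *; have := uvM y xy.1.
  by rewrite mulrDl divfK ?gt_eqF//; lra.
have := uvb y (conj xy.1 Oy); nra.
Qed.

Lemma near_max_slopeN u v x (M eta : R) : Omega x ->
  bounded_cl u -> (forall y, cl y -> u y - v y <= M) ->
  (forall y, bdry y -> u y <= v y) -> 0 <= eta <= M ->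
  M - eta <= u x - v x -> slope (\- v) x <= slope (\- u) x + eta / eps.
Proof.
move=> Ox bu uvM uvb etaM hx.
apply: (@near_max_slope (\- v) (\- u) x M eta) => //.
- exact: bounded_clN.
- by move=> y /uvM /=; lra.
- by move=> y /uvb /=; lra.
- by move: hx => /=; lra.
Qed.

Lemma sup_gap u v x0 : bounded_cl u -> bounded_cl v -> cl x0 ->
  exists M, [/\ u x0 - v x0 <= M, forall y, cl y -> u y - v y <= M &
    forall eta, 0 < eta -> exists2 x, cl x & M - eta < u x - v x].
Proof.
move=> [C uC] [D vD] cx0.
have hs : has_sup [set u y - v y | y in cl].
  split; first by exists (u x0 - v x0), x0.
  exists (C + D) => _ [y cy <-].
  have /ler_normlP[? ?] := uC _ cy; have /ler_normlP[? ?] := vD _ cy; lra.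
exists (sup [set u y - v y | y in cl]); split.
- by apply: ub_le_sup; [exact: hs.2|exists x0].
- by move=> y cy; apply: ub_le_sup; [exact: hs.2|exists y].
- by move=> eta eta0; have [_ [x cx <-] h] := sup_adherent eta0 hs; exists x.
Qed.

(** At a near-maximum of [u - v] the slopes of [u] and [v] are ordered up to
    [eta / eps], which the strict gap [k] excludes. *)
Lemma strict_comparison u v k : 0 < k -> bounded_cl u -> bounded_cl v ->
  (forall y, bdry y -> u y <= v y) ->
  (forall x, Omega x -> slope v x - slope (\- v) x + k <=
                        slope u x - slope (\- u) x) ->
  forall x, cl x -> u x <= v x.
Proof.
move=> k0 bu bv uvb uvk x0 cx0; rewrite leNgt; apply/negP => vu.
have [M [M0 uvM Mx]] := sup_gap bu bv cx0.
pose eta := Num.min M (k * eps / 4).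
have eta0 : 0 < eta.
  by rewrite lt_min; apply/andP; split; [lra|rewrite !mulr_gt0].
have etaM : 0 <= eta <= M by rewrite (ltW eta0) ge_min lexx.
have [x cx hx] := Mx _ eta0.
have Ox : Omega x.
  apply: contrapT => Ox; have := uvb x (conj cx Ox); lra.
have h1 := near_max_slope Ox bv uvM uvb etaM (ltW hx).
have h2 := near_max_slopeN Ox bu uvM uvb etaM (ltW hx).
have h3 := uvk x Ox.
have : eta / eps <= k / 4.
  by rewrite ler_pdivrMr// mulrAC ge_min lexx orbT.
lra.
Qed.

(** As the slopes of [u] and [v] nearly agree at a near-maximum [x] of [u - v],
    [v] cannot climb more than [u] does along a step nearly attaining the slope
    of [u]; so [u - v] hardly decreases. *)
Lemma ascent_step u v x (M eta theta e : R) : Omega x ->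
  bounded_cl u -> bounded_cl v -> (forall y, cl y -> u y - v y <= M) ->
  (forall y, bdry y -> u y <= v y) ->
  slope (\- u) x - slope u x <= slope (\- v) x - slope v x + theta ->
  0 <= eta -> 0 < e -> eta + eps * theta <= e -> 3 * e < M -> eta <= e ->
  M - eta <= u x - v x ->
  slope v x <= slope u x + e / eps /\
  exists y, [/\ Omega y, nbr x y, u x + eps * slope u x - e <= u y &
                M - 3 * e <= u y - v y].
Proof.
move=> Ox bu bv uvM uvb uvk eta0 e0 he eM etae hx.
have etaM : 0 <= eta <= M by rewrite eta0; lra.
have h1 := near_max_slope Ox bv uvM uvb etaM hx.
have h2 := near_max_slopeN Ox bu uvM uvb etaM hx.
have hve : slope v x <= slope u x + e / eps.
  have : (eta + eps * theta) / eps <= e / eps.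
    by rewrite ler_wpM2r// invr_ge0 ltW.
  rewrite mulrDl mulrAC divff ?gt_eqF//; lra.
split => //.
have ee0 : 0 < e / eps by rewrite divr_gt0.
have lt : slope u x - e / eps < slope u x by lra.
have [y xy hy] := slope_lt Ox bu lt.
have sl := step_len_gt0 y Ox; have sle := step_len_le xy.
have hv := slope_ub Ox bv xy.
have see : step_len x y * (e / eps) <= e.
  by rewrite mulrA ler_pdivrMr// [leLHS]mulrC ler_wpM2l// ltW.
have gap : M - 3 * e <= u y - v y.
  have : slope v x * step_len x y <= (slope u x + e / eps) * step_len x y.
    by rewrite ler_wpM2r// ltW.
  lra.
have Oy : Omega y.
  apply: contrapT => Oy; have := uvb y (conj xy.1 Oy); lra.
exists y; split => //.
rewrite step_len_in// in hy.
have : e / eps * eps = e by rewrite divfK// gt_eqF.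
lra.
Qed.

(** A walk along [ascent_step] gains at least [eps * c] per step, up to errors
    which are as small as desired for a fixed number of steps, and thus leaves
    the range of the bounded function [u]. *)
Lemma ascent_comparison u v c : bounded_cl u -> bounded_cl v ->
  (forall y, bdry y -> u y <= v y) ->
  (forall x, Omega x -> slope (\- u) x - slope u x <=
                        slope (\- v) x - slope v x) ->
  0 < c -> (forall x, Omega x -> c <= slope u x) ->
  forall x, cl x -> u x <= v x.
Proof.
move=> bu bv uvb uvk c0 uc x0 cx0; rewrite leNgt; apply/negP => vu.
have [M [M0 uvM Mx]] := sup_gap bu bv cx0.
have Mgt0 : 0 < M by lra.
have walk (K : nat) : forall nu, 0 < nu <= M -> exists2 eta, 0 < eta &
    forall x, Omega x -> M - eta <= u x - v x ->
    exists y, [/\ Omega y, M - nu <= u y - v y &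
                  u x + K%:R * (eps * c) - nu <= u y].
  elim: K => [|K IH] nu /andP[nu0 nuM].
    by exists nu => // x Ox hx; exists x; split => //; lra.
  have h4 : 0 < nu / 4 <= M by apply/andP; split; lra.
  have [eta eta0 H] := IH _ h4.
  exists eta => // x Ox hx; have [y [Oy gy uy]] := H x Ox hx.
  have hk := uvk y Oy; rewrite -[leRHS]addr0 in hk.
  have [||||||_ [z [Oz _ uz gz]]] :=
    @ascent_step u v y M (nu / 4) 0 (nu / 4) Oy bu bv uvM uvb hk => //; try lra.
  exists z; split => //; first lra.
  have : eps * c <= eps * slope u y by rewrite ler_wpM2l ?uc// ltW.
  rewrite -natr1; lra.
have [C uC] := bu.
have ec0 : 0 < eps * c by rewrite mulr_gt0.
have [K KC] : exists K : nat, 2 * C + M < K%:R * (eps * c).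
  exists (Num.bound ((2 * C + M) / (eps * c))).
  rewrite -ltr_pdivrMr//; apply: archi_boundP; apply: divr_ge0; last exact: ltW.
  have : 0 <= C by exact: le_trans (uC _ cx0).
  lra.
have MM : 0 < M <= M by rewrite Mgt0 lexx.
have [eta eta0 H] := walk K M MM.
have e0 : 0 < Num.min eta M by rewrite lt_min eta0.
have [x cx hx] := Mx _ e0.
have [me mM] := min_le2 eta M.
have Ox : Omega x.
  apply: contrapT => Ox; have := uvb x (conj cx Ox); lra.
have [|y [Oy _ uy]] := H x Ox; first lra.
have /ler_normlP[? ?] := uC _ (Omega_cl Oy).
have /ler_normlP[? ?] := uC _ (Omega_cl Ox); lra.
Qed.

(** * Stability of solutions *)

(** The right-hand sides of [u] and [v] need not agree: each is within [k] of
    zero, on the side that matters for comparing [u] with [v] from above. *)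
Definition near_solutions (k : R) u v (M : R) : Prop :=
  [/\ bounded_cl u /\ bounded_cl v, subsol k u, subsol k (\- v),
      forall y, cl y -> u y - v y <= M & forall y, bdry y -> u y <= v y].

Lemma near_solutionsW k k' u v M : k <= k' -> near_solutions k u v M ->
  near_solutions k' u v M.
Proof.
by move=> kk' [b su sv uvM uvb]; split => //; exact: subsolW kk' _.
Qed.

(** Unlike in [ascent_comparison] the slope is not bounded below, but along the
    walk it is not lost: arriving at [y] by a step of slope [s] makes the downward
    slope at [y] at least [s], hence also the upward one, up to the error. The
    order of quantifiers absorbs the errors of [K] steps without computing them. *)
Lemma ascent_walk (K : nat) (nu : R) : 0 < nu -> exists2 eta, 0 < eta &
  forall u v M x, near_solutions eta u v M -> nu <= M -> Omega x ->
  M - eta <= u x - v x ->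
  exists y, [/\ Omega y, M - nu <= u y - v y,
    u x + K%:R * (eps * slope u x) - nu <= u y & slope u x - nu <= slope u y].
Proof.
elim: K nu => [|K IH] nu nu0.
  by exists nu => // u v M x _ _ Ox hx; exists x; split => //; lra.
have ie0 : 0 < eps^-1 by rewrite invr_gt0.
pose A := 7 + 6 * eps + 2 * eps^-1.
have A0 : 0 < A by rewrite /A; have := eps0; lra.
have [nu' nu'0 nuE] : exists2 nu', 0 < nu' &
    nu = 7 * nu' + 6 * (nu' * eps) + 2 * (nu' * eps^-1).
  exists (nu / A); first by rewrite divr_gt0.
  transitivity (nu / A * A); first by rewrite divfK// gt_eqF.
  by rewrite {2}/A; ring.
clear A A0; move: ie0 => _.
have p1 : 0 < nu' * eps by rewrite mulr_gt0.
have p2 : 0 < nu' * eps^-1 by rewrite mulr_gt0// invr_gt0.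
(* [e] is the error of one step, absorbed by the part of [nu] kept in reserve *)
have [e [eE e0 ne eM enu]] : exists e, [/\ e = nu' + 2 * (nu' * eps), 0 < e,
    nu' <= e, 3 * e < nu & e + nu' * eps + nu' <= nu].
  exists (nu' + 2 * (nu' * eps)); split => //; move: nu'0 p1 p2; rewrite ?nuE;
    clear - oO cO eps0; lra.
have ee : e / eps + 2 * nu' <= nu.
  have -> : e / eps = nu' * eps^-1 + 2 * nu'.
    by rewrite eE mulrDl -!mulrA divff ?gt_eqF// mulr1.
  by rewrite nuE; move: nu'0 p1 p2; clear - oO cO eps0; lra.
have [eta0 eta00 H] := IH _ nu'0.
have [le1 le2] := min_le2 eta0 nu'.
exists (Num.min eta0 nu'); first by rewrite lt_min eta00.
move=> u v M x ns nuM Ox hx.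
have nu'M : nu' <= M by move: nuM eM ne e0; clear - oO cO eps0; lra.
have [|y [Oy gy uy sy]] := H u v M x (near_solutionsW le1 ns) nu'M Ox.
  by move: hx le1; clear - oO cO eps0; lra.
have [[bu bv] su sv uvM uvb] := near_solutionsW le2 ns.
have hk : slope (\- u) y - slope u y <=
   slope (\- v) y - slope v y + 2 * nu'.
  by have := su y Oy; have := sv y Oy; rewrite opp_funK; clear - oO cO eps0; lra.
have he : nu' + eps * (2 * nu') <= e by rewrite eE; clear - oO cO eps0; lra.
have eM' : 3 * e < M by exact: lt_le_trans nuM.
have [_ [z [Oz yz uz gz]]] :=
  ascent_step Oy bu bv uvM uvb hk (ltW nu'0) e0 he eM' ne gy.
have slz : slope u y - e / eps <= slope (\- u) z.
  have := slopeN_ub Oz bu (nbr_sym Oy yz); rewrite step_len_in// => h.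
  rewrite -(ler_pM2r eps0) mulrBl divfK ?gt_eqF//.
  by move: h uz; clear - oO cO eps0; lra.
exists z; split => //.
- by move: gz eM; clear - oO cO eps0; lra.
- have : eps * (slope u x - nu') <= eps * slope u y by rewrite ler_wpM2l// ltW.
  by rewrite -natr1; move: uz uy enu; clear - oO cO eps0; lra.
- by have := su z Oz; move: slz sy ee; clear - oO cO eps0; lra.
Qed.

(** A slope above [sigma] would be kept for as many steps as needed to leave the
    range of [u]. *)
Lemma near_max_flat (C sigma nu : R) : 0 < sigma -> 0 < nu ->
  exists2 eta, 0 < eta &
  forall u v M x, near_solutions eta u v M -> (forall y, cl y -> `|u y| <= C) ->
  nu <= M -> Omega x -> M - eta <= u x - v x -> slope u x <= sigma.
Proof.
move=> sigma0 nu0.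
have es0 : 0 < eps * sigma by rewrite mulr_gt0.
pose K := Num.bound ((`|2 * C| + 1) / (eps * sigma)).
have KC : `|2 * C| + 1 < K%:R * (eps * sigma).
  rewrite -ltr_pdivrMr//; apply: archi_boundP; apply: divr_ge0; last exact: ltW.
  by rewrite addr_ge0.
have n0 : 0 < Num.min nu 1 by rewrite lt_min nu0 ltr01.
have [nn n1] := min_le2 nu 1.
have [eta eta0 H] := ascent_walk K n0.
exists eta => // u v M x ns uC nuM Ox hx.
have [|y [Oy _ uy _]] := H u v M x ns _ Ox hx; first lra.
rewrite leNgt; apply/negP => ss.
have : K%:R * (eps * sigma) <= K%:R * (eps * slope u x).
  by rewrite ler_wpM2l// ler_wpM2l// ltW.
have := ler_norm (2 * C).
have /ler_normlP[? ?] := uC _ (Omega_cl Oy).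
have /ler_normlP[? ?] := uC _ (Omega_cl Ox).
lra.
Qed.

(** At a near-maximum all four slopes are small, so that neither [u] nor [v]
    changes much in the ball around it, and neither does [u - v]. *)
Lemma near_max_spread (C m0 nu : R) : 0 < m0 -> 0 < nu ->
  exists2 eta, 0 < eta &
  forall u v M x, near_solutions eta u v M -> (forall y, cl y -> `|u y| <= C) ->
  m0 <= M -> Omega x -> M - eta <= u x - v x ->
  forall y, nbr x y -> M - nu <= u y - v y.
Proof.
move=> m00 nu0.
pose sigma := nu / (4 * eps).
have sigma0 : 0 < sigma by rewrite divr_gt0// mulr_gt0.
have sigmaE : sigma * eps = nu / 4 by rewrite /sigma; field; rewrite gt_eqF.
have [eta1 eta10 H] := near_max_flat C sigma0 m00.
pose A := 4 + 6 * eps.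
have A0 : 0 < A by rewrite /A; have := eps0; lra.
pose eta2 := Num.min (nu / 2 / A) (m0 / (2 * A)).
have eta20 : 0 < eta2 by rewrite lt_min !divr_gt0// mulr_gt0.
pose eta := Num.min eta1 eta2.
have [le1 le2] := min_le2 eta1 eta2; rewrite -/eta in le1 le2.
have eta0 : 0 < eta by rewrite lt_min eta10.
have etaA : eta * A <= nu / 2.
  by rewrite -ler_pdivlMr//; apply: le_trans le2 _; rewrite ge_min lexx.
have etaB : eta * A <= m0 / 2.
  rewrite -ler_pdivlMr// -mulrA -invfM; apply: le_trans le2 _.
  by rewrite ge_min lexx orbT.
exists eta => // u v M x ns uC mM Ox hx y xy.
have sx : slope u x <= sigma.
  by apply: (H u v M x (near_solutionsW le1 ns) uC mM Ox); lra.
have [[bu bv] su sv uvM uvb] := ns.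
have su' := su x Ox; have := sv x Ox; rewrite opp_funK => sv'.
have hk : slope (\- u) x - slope u x <=
   slope (\- v) x - slope v x + 2 * eta by lra.
pose e := eta + 2 * (eta * eps).
have p1 : 0 < eta * eps by rewrite mulr_gt0.
have he : eta + eps * (2 * eta) <= e by rewrite /e; lra.
have e0 : 0 < e by rewrite /e; lra.
have eM : 3 * e < M by rewrite /e; rewrite /A in etaB; lra.
have ne : eta <= e by rewrite /e; lra.
have [sv1 _] := ascent_step Ox bu bv uvM uvb hk (ltW eta0) e0 he eM ne hx.
have sl := step_len_gt0 y Ox; have sle := step_len_le xy.
have h1 := slopeN_ub Ox bu xy; have h2 := slope_ub Ox bv xy.
have slope_step (a b : R) : a <= b -> 0 <= b -> a * step_len x y <= b * eps.
  move=> ab b0; apply: (@le_trans _ _ (b * step_len x y)).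
    by rewrite ler_wpM2r// ltW.
  by rewrite ler_wpM2l.
have h3 : slope (\- u) x * step_len x y <= (sigma + eta) * eps.
  by apply: slope_step; lra.
have h4 : slope v x * step_len x y <= (sigma + e / eps) * eps.
  apply: slope_step; first by apply: le_trans sv1 _; rewrite lerD2r.
  by apply: addr_ge0; [exact: ltW|apply: divr_ge0; exact: ltW].
rewrite mulrDl divfK ?gt_eqF// in h4; rewrite /e /A in etaA h4; lra.
Qed.

(** Near-maxima propagate along the segment from [x] to a boundary point [p], in
    steps of length [eps]; the segment stays inside by convexity. At [p] the
    difference [u - v] is nonpositive. *)
Lemma near_max_chain (C m0 : R) p (N : nat) : bdry p -> 0 < m0 ->
  forall nu, 0 < nu -> exists2 eta, 0 < eta &
  forall u v M x, near_solutions eta u v M -> (forall y, cl y -> `|u y| <= C) ->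
  m0 <= M -> Omega x -> enorm (p - x) <= N%:R * eps ->
  M - eta <= u x - v x -> M <= nu.
Proof.
move=> [cp Op] m00; elim: N => [|N IH] nu nu0.
  exists nu => // u v M x _ _ _ Ox; rewrite mul0r => px.
  have /eqP : p - x = 0 by apply: enorm_eq0; apply/le_anti; rewrite px enorm_ge0.
  by rewrite subr_eq0 => /eqP px'; move: Op; rewrite px'.
have [eta1 eta10 H1] := IH nu nu0.
have n0 : 0 < Num.min eta1 nu by rewrite lt_min eta10.
have [le1 le2] := min_le2 eta1 nu.
have [eta2 eta20 H2] := near_max_spread C m00 n0.
pose eta := Num.min eta1 eta2.
have [le3 le4] := min_le2 eta1 eta2; rewrite -/eta in le3 le4.
have eta0 : 0 < eta by rewrite lt_min eta10.
exists eta => // u v M x ns uC mM Ox px hx.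
have spread : forall y, nbr x y -> M - Num.min eta1 nu <= u y - v y.
  by apply: (H2 u v M x (near_solutionsW le4 ns) uC mM Ox); lra.
have [_ _ _ _ uvb] := ns.
have [pe|pe] := leP (enorm (p - x)) eps.
  by have := spread p (conj cp pe); have := uvb p (conj cp Op); lra.
have pos : 0 < enorm (p - x) by exact: lt_trans pe.
pose t := eps / enorm (p - x).
have t01 : 0 <= t < 1.
  by rewrite divr_ge0 ?(ltW eps0) ?(ltW pos)//= ltr_pdivrMr// mul1r.
have tE : t * enorm (p - x) = eps by rewrite divfK// gt_eqF.
pose y := x + t *: (p - x).
have Oy : Omega y by exact: convex_segment_closure.
have xy : nbr x y.
  split; first exact: Omega_cl.
  by rewrite /y addrC addKr enormZ ger0_norm ?tE//; case/andP: t01.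
apply: (H1 u v M y (near_solutionsW le3 ns) uC mM Oy).
  have -> : p - y = (1 - t) *: (p - x).
    by rewrite /y; apply/rowP => i; rewrite !mxE; ring.
  rewrite enormZ ger0_norm; last by case/andP: t01; lra.
  by rewrite mulrBl tE mul1r; rewrite -natr1 in px; lra.
by have := spread y xy; lra.
Qed.

(** Otherwise near-maxima of [u - v], of value above [m0], would propagate to the
    boundary. As [k] serves all functions bounded by [C], this gives both the
    effect of a small right-hand side and, with [m0] arbitrary, a comparison
    principle for the homogeneous equation. *)
Lemma stability (C m0 : R) p : (exists B, forall x, Omega x -> enorm x <= B) ->
  bdry p -> 0 < m0 ->
  exists2 k, 0 < k &
  forall u v, (forall y, cl y -> `|u y| <= C) -> bounded_cl v ->
  subsol k u -> subsol k (\- v) -> (forall y, bdry y -> u y <= v y) ->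
  forall x, cl x -> u x <= v x + m0.
Proof.
move=> [B hB] bp m00.
pose N := Num.bound ((`|B| + enorm p) / eps).
have NE : `|B| + enorm p < N%:R * eps.
  rewrite -ltr_pdivrMr//; apply: archi_boundP; apply: divr_ge0; last exact: ltW.
  by rewrite addr_ge0// enorm_ge0.
have h20 : 0 < m0 / 2 by lra.
have [k k0 H] := near_max_chain C N bp m00 h20.
exists k => // u v uC bv su sv uvb x0 cx0; rewrite leNgt; apply/negP => gap.
have bu : bounded_cl u by exists C.
have [M [M0 uvM Mx]] := sup_gap bu bv cx0.
have e0 : 0 < Num.min k m0 by rewrite lt_min k0.
have [le1 le2] := min_le2 k m0.
have [x cx hx] := Mx _ e0.
have Ox : Omega x.
  apply: contrapT => Ox; have := uvb x (conj cx Ox); lra.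
have : M <= m0 / 2.
  apply: (H u v M x) => //; try lra.
  apply: le_trans (enormD _ _) _; rewrite enormN.
  have := hB x Ox; have := ler_norm B; lra.
lra.
Qed.

(** * Barriers and Perron's method *)

Context {B : R} (i0 : 'I_n).
Hypothesis bO : forall x, Omega x -> enorm x <= B.

Lemma exit_bdry x (w : 'rV[R]_n) : Omega x -> ~ Omega w ->
  exists2 t, 0 < t <= 1 & bdry (x + t *: (w - x)).
Proof.
move=> Ox Ow; have [t t01 b] := exit_point oO Ox Ow.
by exists t => //; apply/boundary_openP.
Qed.

(** The barrier is a convex quadratic function of the coordinate [i0], lowered
    inside the domain by a large constant. The constant makes every boundary
    value too high to matter for the downward slope, and high enough to replace
    the missing interior endpoint when a step in direction [i0] leaves the
    domain. Away from the boundary the second difference of the square gives the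
    gap [2 * eps]. *)
Lemma barrier g G : (forall y, bdry y -> `|g y| <= G) ->
  exists L, [/\ bounded_cl L, forall y, bdry y -> L y = g y &
    forall x, Omega x -> 2 * eps <= slope L x - slope (\- L) x].
Proof.
move=> gG.
pose C := (2 * B + 2 * eps) ^+ 2 + G.
pose q x := (x 0 i0 + B + eps) ^+ 2 - C.
pose L x := if `[< Omega x >] then q x else g x.
have LO x : Omega x -> L x = q x by rewrite /L; case: asboolP.
have Lb x : bdry x -> L x = g x by case; rewrite /L; case: asboolP.
have e0 := eps0.
have xB x : Omega x -> - B <= x 0 i0 <= B.
  move=> Ox; rewrite -ler_norml; apply: le_trans (bO Ox).
  exact: coord_le_enorm.
have bL : bounded_cl L.
  exists (`|G| + `|C| + (2 * B + 2 * eps) ^+ 2) => x cx.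
  have sq : 0 <= (2 * B + 2 * eps) ^+ 2 by exact: sqr_ge0.
  have [Ox|Ox] := pselect (Omega x).
    rewrite LO// /q; apply: le_trans (ler_normB _ _) _.
    have /andP[b1 b2] := xB x Ox.
    rewrite ger0_norm ?sqr_ge0//.
    have : (x 0 i0 + B + eps) ^+ 2 <= (2 * B + 2 * eps) ^+ 2.
      by rewrite ler_pXn2r ?nnegrE//; lra.
    have := normr_ge0 G; lra.
  rewrite Lb//; apply: le_trans (gG x _) _ => //.
  have := ler_norm G; have := normr_ge0 C; lra.
exists L; split => // x Ox.
have /andP[t1 t2] := xB x Ox; set t := x 0 i0 in t1 t2.
have Lx : L x = (t + B + eps) ^+ 2 - C by rewrite LO.
have down : slope (\- L) x <= 2 * t + 2 * B + eps.
  apply: slope_le => // y [cy xy] /=.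
  have [Oy|Oy] := pselect (Omega y).
    rewrite step_len_in// Lx LO// /q.
    have : `|(y - x) 0 i0| <= eps by apply: le_trans (coord_le_enorm _ _) xy.
    rewrite !mxE -/t => /ler_normlP[s1 s2].
    have : (t + B) ^+ 2 <= (y 0 i0 + B + eps) ^+ 2.
      by rewrite ler_pXn2r ?nnegrE//; lra.
    lra.
  have /ler_normlP[g1 g2] := gG y (conj cy Oy).
  have sl := step_len_gt0 y Ox.
  have p : 0 <= (2 * t + 2 * B + eps) * step_len x y.
    by apply: mulr_ge0; [lra|exact: ltW].
  have : (t + B + eps) ^+ 2 <= (2 * B + 2 * eps) ^+ 2.
    by rewrite ler_pXn2r ?nnegrE//; lra.
  rewrite Lx Lb// /C; lra.
have up : 2 * t + 2 * B + 3 * eps <= slope L x.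
  rewrite -(ler_pM2r e0).
  pose e : 'rV[R]_n := eps *: delta_mx 0 i0.
  have ee : enorm e = eps.
    rewrite /e enormZ gtr0_norm//.
    suff -> : enorm (delta_mx 0 i0 : 'rV[R]_n) = 1 by rewrite mulr1.
    apply/eqP; rewrite -(@eqrXn2 _ 2) ?enorm_ge0 ?ler01// enorm_sq /dotp.
    rewrite (bigD1 i0)//= big1 => [|j ji]; last by rewrite !mxE (negbTE ji) mul0r.
    by rewrite !mxE !eqxx mulr1 addr0 expr1n.
  have [Ow|Ow] := pselect (Omega (x + e)).
    have xw : nbr x (x + e).
      split; first exact: Omega_cl.
      by rewrite addrC addKr ee.
    have := slope_ub Ox bL xw; rewrite step_len_in// Lx LO// /q.
    by rewrite !mxE !eqxx mulr1 -/t; lra.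
  have [s /andP[s0 s1] bq] := exit_bdry Ox Ow.
  set z := x + _ in bq.
  have zx : enorm (z - x) = s * eps.
    by rewrite /z addrC addKr enormZ ger0_norm ?(ltW s0)// addrC addKr ee.
  have xz : nbr x z by split; [exact: bq.1|rewrite zx ler_piMl// ltW].
  have h := slope_ub Ox bL xz.
  have : slope L x * step_len x z <= slope L x * eps.
    by rewrite ler_wpM2l ?slope_ge0// step_len_le.
  have /ler_normlP[g1 g2] := gG z bq.
  rewrite Lx Lb// /C in h.
  have : (t + B + 2 * eps) ^+ 2 <= (2 * B + 2 * eps) ^+ 2.
    by rewrite ler_pXn2r ?nnegrE//; lra.
  lra.
lra.
Qed.

Lemma subsol_upper_bound g G : (forall y, bdry y -> `|g y| <= G) ->
  exists C, forall u, bounded_cl u -> (forall y, bdry y -> u y <= g y) ->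
  subsol eps u -> forall x, cl x -> u x <= C.
Proof.
move=> gG.
have gG' y : bdry y -> `|(\- g) y| <= G by move=> /gG /=; rewrite normrN.
have [L [bL Lg LO]] := barrier gG'.
have [C LC] := bL.
exists C => u bu ug su x cx.
have ux : forall x, cl x -> u x <= (\- L) x.
  apply: (strict_comparison eps0) => //.
  - exact: bounded_clN.
  - by move=> y yb /=; rewrite Lg//= opprK; exact: ug.
  - move=> y Oy; rewrite opp_funK; have := LO y Oy; have := su y Oy; lra.
by apply: le_trans (ux x cx) _; have /ler_normlP[] := LC x cx.
Qed.

(** For comparing a supremum of functions with its members in Perron's method;
    [r] enters because steps to the boundary may be short. *)
Lemma slope_mono u w x (eta r : R) : Omega x -> bounded_cl u ->
  (forall y, nbr x y -> w y <= u y) -> u x - eta <= w x -> 0 <= eta ->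
  0 < r -> (forall y, r <= step_len x y) -> slope w x <= slope u x + eta / r.
Proof.
move=> Ox bu wu uw eta0 r0 rl; apply: slope_le => // y xy.
have h := slope_ub Ox bu xy; have := wu y xy.
have : eta <= eta / r * step_len x y.
  by rewrite mulrAC ler_pdivlMr// ler_wpM2l.
lra.
Qed.

Definition subsol_class (f g w : 'rV[R]_n -> R) : Prop :=
  [/\ bounded_cl w, forall y, bdry y -> w y = g y &
      forall x, Omega x -> slope (\- w) x - slope w x <= eps * f x].

(** The supremum [u] of the subsolutions is a subsolution since each is below [u]
    everywhere and some is close to it at any given point. Where the equation
    failed, raising [u] at that point alone would give a larger subsolution. *)
Lemma perron f g G : (forall y, bdry y -> `|g y| <= G) ->
  (forall x, Omega x -> `|f x| <= 1) ->
  exists u, [/\ bounded_cl u, forall y, bdry y -> u y = g y &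
    forall x, Omega x -> slope (\- u) x - slope u x = eps * f x].
Proof.
move=> gG f1; have e0 := eps0.
have ef x : Omega x -> - eps <= eps * f x <= eps.
  move=> /f1 /ler_normlP[f2 f3]; apply/andP; split; nra.
have [C wC] := subsol_upper_bound gG.
have WC w x : subsol_class f g w -> cl x -> w x <= C.
  case=> bw wg sw; apply: wC => //; first by move=> y /wg ->.
  by move=> y Oy; have := sw y Oy; have /andP[] := ef y Oy; lra.
have [L [bL Lg LO]] := barrier gG.
have WL : subsol_class f g L.
  by split => // x Ox; have := LO x Ox; have /andP[] := ef x Ox; lra.
pose u x := if `[< Omega x >] then sup [set w x | w in subsol_class f g] else g x.
have uO x : Omega x -> u x = sup [set w x | w in subsol_class f g].
  by rewrite /u; case: asboolP.
have ub y : bdry y -> u y = g y by case; rewrite /u; case: asboolP.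
have hs x : Omega x -> has_sup [set w x | w in subsol_class f g].
  move=> Ox; split; first by exists (L x), L.
  by exists C => _ [w Ww <-]; apply: WC => //; exact: Omega_cl.
have wu w y : subsol_class f g w -> cl y -> w y <= u y.
  move=> Ww cy; have [Oy|Oy] := pselect (Omega y).
    by rewrite uO//; apply: ub_le_sup; [exact: (hs y Oy).2|exists w].
  by rewrite ub//; case: Ww => _ -> //.
have bu : bounded_cl u.
  have [D LD] := bL; exists (`|C| + `|G| + `|D|) => y cy.
  have [Oy|Oy] := pselect (Omega y); last first.
    rewrite ub//; have := gG y (conj cy Oy).
    by have := normr_ge0 C; have := normr_ge0 D; have := ler_norm G; lra.
  have uC : u y <= C.
    rewrite uO//; apply: ge_sup; first by exists (L y), L.
    by move=> _ [w Ww <-]; exact: WC.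
  have := wu L y WL cy; have /ler_normlP[] := LD y cy.
  have := normr_ge0 C; have := normr_ge0 G; have := normr_ge0 D.
  have := ler_norm C; have := ler_norm D => *; apply/ler_normlP; split; lra.
have sub x : Omega x -> slope (\- u) x - slope u x <= eps * f x.
  move=> Ox; apply/ler_addgt0Pr => e ep.
  have [r r0 rl] := step_len_lb Ox.
  have d0 : 0 < e * r / 2 by rewrite divr_gt0// mulr_gt0.
  have [_ [w Ww <-]] := sup_adherent d0 (hs x Ox); rewrite -uO// => hw.
  have [bw wg sw] := Ww; have sx := sw x Ox.
  have cw y : nbr x y -> w y <= u y by case=> cy _; exact: wu.
  have h1 := slope_mono Ox bu cw (ltW hw) (ltW d0) r0 rl.
  have h2 : slope (\- u) x <= slope (\- w) x + e * r / 2 / r.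
    apply: slope_mono (bounded_clN bw) _ _ (ltW d0) r0 rl => //=.
      by move=> y /cw; lra.
    by lra.
  have er : e * r / 2 / r = e / 2 by field; rewrite gt_eqF.
  by rewrite er in h1 h2; lra.
exists u; split => // x Ox; apply/le_anti; rewrite sub//=.
rewrite leNgt; apply/negP => gap.
have [r r0 rl] := step_len_lb Ox.
pose d := eps * f x - (slope (\- u) x - slope u x).
have d0 : 0 < d by rewrite subr_gt0.
pose tau := d * r / 2.
have tau0 : 0 < tau by rewrite divr_gt0// mulr_gt0.
have taur : tau / r = d / 2 by rewrite /tau; field; rewrite gt_eqF.
(* raising the supremum at one point only would keep it a subsolution *)
pose w y := if y == x then u y + tau else u y.
have wx : w x = u x + tau by rewrite /w eqxx.
have uw y : u y <= w y by rewrite /w; case: eqP => // _; lra.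
have bw : bounded_cl w.
  have [D uD] := bu; exists (D + tau) => y cy; have /ler_normlP[u1 u2] := uD y cy.
  by rewrite /w; case: eqP => _; apply/ler_normlP; split; lra.
have Ww : subsol_class f g w.
  split=> // [y yb|y Oy].
    rewrite /w; case: eqP => [yx|_]; last exact: ub.
    by case: yb => _; rewrite yx.
  have [yx|yx] := eqVneq y x.
    rewrite {y Oy}yx.
    have h1 : slope u x <= slope w x + tau / r.
      by apply: slope_mono (ltW tau0) r0 rl => //; rewrite wx; lra.
    have h2 : slope (\- w) x <= slope (\- u) x + tau / r.
      apply: slope_mono (bounded_clN bu) _ _ (ltW tau0) r0 rl => //=.
        by move=> y _; have := uw y; lra.
      by rewrite wx; lra.
    by rewrite taur /d in h1 h2; lra.
  have wy : w y = u y by rewrite /w (negbTE yx).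
  have [s s0 sl] := step_len_lb Oy.
  have h1 : slope u y <= slope w y + 0 / s.
    by apply: slope_mono s0 sl => //; rewrite wy; lra.
  have h2 : slope (\- w) y <= slope (\- u) y + 0 / s.
    apply: slope_mono (bounded_clN bu) _ _ _ s0 sl => //=.
      by move=> z _; have := uw z; lra.
    by rewrite wy; lra.
  by have := sub y Oy; rewrite mul0r in h1 h2; lra.
by have := wu w x Ww (Omega_cl Ox); rewrite wx; lra.
Qed.

(** * Semicontinuous envelopes *)

Definition bdry_continuous (g : 'rV[R]_n -> R) := forall p e, bdry p -> 0 < e ->
  exists2 r, 0 < r & forall q, bdry q -> enorm (q - p) < r -> `|g q - g p| < e.

(** If [u x > g p + e] at distance [d] from [p], the downward slope at [x] exceeds
    [e / d], hence so does the upward slope. As [u] is bounded, a step of such a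
    slope must end on the boundary and have length of order [d]: its endpoint is
    near [p], where [g] does not exceed [g p + e]. *)
Lemma bdry_upper g u p e : bdry_continuous g -> bounded_cl u -> subsol 0 u ->
  (forall y, bdry y -> u y = g y) -> bdry p -> 0 < e ->
  exists2 r, 0 < r & forall x, cl x -> enorm (x - p) < r -> u x <= g p + e.
Proof.
move=> g_cont bu su ug bp e0; have [C uC] := bu.
have [r0 r00 gr] := g_cont p e bp e0.
have ep := eps0.
pose D := 2 * (`|C| + 1).
have D0 : 0 < D by rewrite mulr_gt0// ltr_pwDr.
have uD x y : cl x -> cl y -> u y - u x < D.
  move=> /uC/ler_normlP[? ?] /uC/ler_normlP[? ?]; rewrite /D.
  by have := ler_norm C; lra.
pose r1 := Num.min (eps * e / D) (r0 / (1 + D / e)).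
have De0 : 0 < D / e by rewrite divr_gt0.
have r10 : 0 < r1.
  rewrite lt_min; apply/andP; split; first by rewrite divr_gt0// mulr_gt0.
  by rewrite divr_gt0//; lra.
exists (Num.min r0 (Num.min eps r1)); first by rewrite lt_min r00 lt_min ep r10.
move=> x cx; rewrite !lt_min => /andP[xr0 /andP[xeps /andP[xe xr1]]].
have [Ox|Ox] := pselect (Omega x); last first.
  rewrite ug//; have := gr x (conj cx Ox) xr0.
  by move=> /ltW/ler_normlP[_]; lra.
rewrite leNgt; apply/negP => gap.
set d := enorm (x - p) in xr0 xeps xe xr1.
have d0 : 0 < d.
  apply: enorm_gt0; rewrite subr_eq0; apply/eqP => xp.
  by case: bp => _; rewrite -xp.
have xp : nbr x p by split; [exact: bp.1|rewrite enormBC; exact: ltW].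
have h := slopeN_ub Ox bu xp.
rewrite step_len_bd in h; last exact: bp.2.
rewrite (ug p bp) enormBC -/d in h.
have s1 : e / d < slope (\- u) x by rewrite ltr_pdivrMr//; lra.
have s2 : e / d < slope u x by have := su x Ox; lra.
have [y xy hy] := slope_lt Ox bu s2.
have := uD x y cx xy.1.
have ed0 : 0 < e / d by rewrite divr_gt0.
have [Oy|Oy] := pselect (Omega y).
  rewrite step_len_in// in hy => uyx.
  have : e / d * eps < D by lra.
  rewrite mulrAC ltr_pdivrMr// => /lt_gtF.
  by rewrite mulrC -ltr_pdivlMr// [e * eps]mulrC xe.
rewrite step_len_bd// in hy => uyx.
have y1 : e / d * enorm (y - x) < D by lra.
have y2 : enorm (y - x) < D / e * d.
  rewrite -(ltr_pM2l ed0); have -> // : e / d * (D / e * d) = D.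
  by field; rewrite !gt_eqF.
have y3 : enorm (y - p) < r0.
  apply: le_lt_trans (enorm_tri p x y) _; rewrite -/d.
  have : d * (1 + D / e) < r0 by rewrite -ltr_pdivlMr//; lra.
  lra.
have /ltW/ler_normlP[_ ?] := gr y (conj xy.1 Oy) y3.
have : 0 <= e / d * enorm (y - x) by rewrite mulr_ge0 ?enorm_ge0// ltW.
rewrite ug// in hy; last by split => //; exact: xy.1.
lra.
Qed.

(** The upper semicontinuous envelope on the closure. *)
Definition usc_env u x : R :=
  inf [set a | exists2 r, 0 < r & forall y, cl y -> enorm (y - x) < r -> u y <= a].

Lemma usc_env_has_inf u x : bounded_cl u -> cl x ->
  has_inf [set a | exists2 r, 0 < r &
    forall y, cl y -> enorm (y - x) < r -> u y <= a].
Proof.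
move=> [C uC] cx; split.
  by exists C, 1 => // y cy _; have /ler_normlP[] := uC y cy.
exists (u x) => a [r r0 ra]; apply: ra => //.
by rewrite subrr enorm0.
Qed.

Lemma usc_env_ge u x : bounded_cl u -> cl x -> u x <= usc_env u x.
Proof.
move=> bu cx; apply: lb_le_inf; first exact: (usc_env_has_inf bu cx).1.
by move=> a [r r0 ra]; apply: ra => //; rewrite subrr enorm0.
Qed.

Lemma usc_env_le u x a r : bounded_cl u -> cl x -> 0 < r ->
  (forall y, cl y -> enorm (y - x) < r -> u y <= a) -> usc_env u x <= a.
Proof.
move=> bu cx r0 ra; apply: ge_inf; first exact: (usc_env_has_inf bu cx).2.
by exists r.
Qed.

Lemma usc_env_near u x e : bounded_cl u -> cl x -> 0 < e ->
  exists2 r, 0 < r &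
  forall y, cl y -> enorm (y - x) < r -> u y <= usc_env u x + e.
Proof.
move=> bu cx e0.
have [a [r r0 ra] ae] := inf_adherent e0 (usc_env_has_inf bu cx).
by exists r => // y cy yr; apply: le_trans (ra y cy yr) _; exact: ltW.
Qed.

Lemma usc_env_approx u x e r : bounded_cl u -> cl x -> 0 < e -> 0 < r ->
  exists y, [/\ cl y, enorm (y - x) < r & usc_env u x - e < u y].
Proof.
move=> bu cx e0 r0; apply: contrapT => h.
have : usc_env u x <= usc_env u x - e.
  apply: (usc_env_le bu cx r0) => y cy yr; rewrite leNgt; apply/negP => yu.
  by apply: h; exists y.
lra.
Qed.

Lemma usc_env_bounded u C : (forall x, cl x -> `|u x| <= C) ->
  forall x, cl x -> `|usc_env u x| <= C.
Proof.
move=> uC x cx; have bu : bounded_cl u by exists C.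
have := usc_env_ge bu cx; have /ler_normlP[? ?] := uC x cx.
have : usc_env u x <= C.
  by apply: (usc_env_le bu cx ltr01) => y /uC/ler_normlP[].
by move=> *; apply/ler_normlP; split; lra.
Qed.

Lemma usc_env_bdry g u : bdry_continuous g -> bounded_cl u -> subsol 0 u ->
  (forall y, bdry y -> u y = g y) -> forall y, bdry y -> usc_env u y = g y.
Proof.
move=> g_cont bu su ug p bp; apply/le_anti; apply/andP; split; last first.
  by rewrite -ug//; apply: usc_env_ge => //; exact: bp.1.
apply/ler_addgt0Pr => e e0.
have [r r0 h] := bdry_upper g_cont bu su ug bp e0.
exact: usc_env_le bu bp.1 r0 h.
Qed.

Lemma step_len_lsc x z e : 0 < e -> enorm (z - x) <= eps ->
  exists2 r, 0 < r & forall z', enorm (z' - z) < r ->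
    step_len x z - e <= step_len x z'.
Proof.
move=> e0 zx; have [Oz|Oz] := pselect (Omega z).
  have [r r0 rO] := open_enorm oO Oz.
  by exists r => // z' /rO Oz'; rewrite !step_len_in//; lra.
exists e => // z' z'z; rewrite (step_len_bd _ Oz).
have [Oz'|Oz'] := pselect (Omega z'); first by rewrite step_len_in//; lra.
by rewrite step_len_bd//; have := enorm_tri x z' z; rewrite (enormBC z z'); lra.
Qed.

Lemma compact_cl : compact cl.
Proof.
apply: bounded_closed_compact; last exact: closed_closure.
exists B; split; first exact: num_real.
move=> M BM z cz; apply: le_trans (norm_le_enorm z) _.
apply/ler_addgt0Pr => e e0; have /closure_enormP/(_ e e0)[y Oy yz] := cz.
have := enormD y (z - y); rewrite addrC subrK (enormBC z).
have := bO Oy; have := BM; lra.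
Qed.

(** The endpoint of a step nearly attaining the slope moves with the point; the
    bound on the slope of the envelope at [x] controls the endpoints near each
    given one, and compactness of the closure controls all of them at once. *)
Lemma usc_env_slope_up u x a : bounded_cl u -> Omega x ->
  slope (usc_env u) x < a -> exists2 r, 0 < r &
  forall x', Omega x' -> enorm (x' - x) < r -> usc_env u x - r <= u x' ->
  slope u x' <= a.
Proof.
move=> bu Ox; set U := usc_env u; set b := slope U x => ba.
have bU : bounded_cl U by have [C uC] := bu; exists C; exact: usc_env_bounded.
have b0 : 0 <= b by exact: slope_ge0.
have a0 : 0 < a by exact: le_lt_trans ba.
have ccl := compact_cl.
have [r r0 H] : exists2 r, 0 < r & forall z, cl z ->
    forall x', Omega x' -> enorm (x' - x) < r -> U x - r <= u x' ->
    nbr x' z -> u z - u x' <= a * step_len x' z.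
  apply: (compact_uniform (P := fun r z => forall x', Omega x' ->
      enorm (x' - x) < r -> U x - r <= u x' -> nbr x' z ->
      u z - u x' <= a * step_len x' z) ccl).
    move=> r r' z r'0 r'r h x' Ox' x'x ux'.
    by apply: h => //; [exact: lt_le_trans r'r|lra].
  move=> z cz; have [zx|zx] := ltP eps (enorm (z - x)).
    exists ((enorm (z - x) - eps) / 2); first by rewrite divr_gt0// subr_gt0.
    move=> y cy yz x' Ox' x'x _ [_ yx'].
    have := enorm_tri x y z; have := enorm_tri x x' y.
    by rewrite (enormBC z y); lra.
  have xz : nbr x z by [].
  have hb := slope_ub Ox bU xz; rewrite -/b in hb.
  set d := step_len x z in hb.
  have d0 : 0 < d by exact: step_len_gt0.
  have e0 : 0 < (a - b) * d / 2 by rewrite divr_gt0// mulr_gt0// subr_gt0.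
  have [r1 r10 h1] := usc_env_near bu cz e0; rewrite -/U in h1.
  have a1 : 0 < 2 * (1 + 2 * a) by lra.
  pose q := (a - b) * d / (2 * (1 + 2 * a)).
  have q0 : 0 < q by rewrite divr_gt0// mulr_gt0// subr_gt0.
  have qE : (a - b) * d / 2 = q + 2 * (a * q).
    by rewrite /q; field; rewrite gt_eqF//; lra.
  have [r2 r20 h2] := step_len_lsc q0 zx; rewrite -/d in h2.
  exists (Num.min r1 (Num.min r2 q)); first by rewrite !lt_min r10 r20.
  move=> z' cz'; rewrite !lt_min => /andP[z1 /andP[z2 z3]] x' Ox'.
  rewrite !lt_min => /andP[x1 /andP[x2 x3]] ux' x'z'.
  have ux : U x - q <= u x'.
    apply: le_trans ux'; rewrite lerD2l lerN2.
    by rewrite !ge_min lexx !orbT.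
  have uz := h1 z' cz' z1; have sz := h2 z' z2.
  have st : d - 2 * q <= step_len x' z'.
    have [Oz'|Oz'] := pselect (Omega z').
      rewrite step_len_in// in sz; rewrite step_len_in//.
      by move: sz q0; clear - oO cO eps0; lra.
    rewrite step_len_bd// in sz; rewrite step_len_bd//; have := enorm_tri x x' z'.
    by move: sz x3; clear - oO cO eps0; lra.
  have : a * (d - 2 * q) <= a * step_len x' z' by rewrite ler_wpM2l// ltW.
  by move: uz ux hb qE; clear - oO cO eps0; lra.
exists r => // x' Ox' x'x ux'; apply: slope_le => // z x'z.
exact: H x'z.1 _ Ox' x'x ux' x'z.
Qed.

(** A single endpoint [y] witnesses the slope of the envelope at [x], and nearby
    points still see [y] or an interior point close to it. *)
Lemma usc_env_slope_down u x a : bounded_cl u -> Omega x -> 0 <= a ->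
  a < slope (\- usc_env u) x -> exists2 r, 0 < r &
  forall x', Omega x' -> enorm (x' - x) < r -> usc_env u x - r <= u x' ->
  a <= slope (\- u) x'.
Proof.
move=> bu Ox a0; set U := usc_env u => au.
have bU : bounded_cl U by have [C uC] := bu; exists C; exact: usc_env_bounded.
have [y xy] := slope_lt Ox (bounded_clN bU) au.
have -> : (\- U) y - (\- U) x = U x - U y by rewrite [RHS]addrC -[U x in RHS]opprK.
move=> hy; set s := U x - U y - a * step_len x y.
have s0 : 0 < s by rewrite subr_gt0.
have ep := eps0.
suff [r r0 H] : exists2 r, 0 < r & forall x', Omega x' -> enorm (x' - x) < r ->
    U x - r <= u x' -> exists2 y', nbr x' y' & a * step_len x' y' <= u x' - u y'.
  exists r => // x' Ox' x'x ux'; have [y' x'y' h] := H x' Ox' x'x ux'.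
  have := slopeN_ub Ox' bu x'y' => h'.
  rewrite -(ler_pM2r (step_len_gt0 y' Ox')); exact: le_trans h'.
have uy := usc_env_ge bu xy.1; rewrite -/U in uy.
have [yx|yx] := ltP (enorm (y - x)) eps.
  pose r := Num.min (eps - enorm (y - x)) (s / (1 + a)).
  exists r; first by rewrite lt_min subr_gt0 yx divr_gt0//; lra.
  have rs : r * (1 + a) <= s.
    by rewrite -ler_pdivlMr; [rewrite /r ge_min lexx orbT|lra].
  have re : r <= eps - enorm (y - x) by rewrite /r ge_min lexx.
  move=> x' Ox' x'x ux'; exists y.
    split; first exact: xy.1.
    by have := enorm_tri x' x y; rewrite (enormBC x x'); lra.
  have st : step_len x' y <= step_len x y + r.
    have [Oy|Oy] := pselect (Omega y).
      rewrite !step_len_in// lerDl; apply: le_trans (ltW x'x).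
      exact: enorm_ge0.
    rewrite !step_len_bd//; have := enorm_tri x' x y.
    by rewrite (enormBC x x'); lra.
  have : a * step_len x' y <= a * (step_len x y + r) by rewrite ler_wpM2l.
  by move: rs ux' uy; rewrite /s; clear - oO cO eps0; lra.
(* an endpoint at distance exactly [eps] is first pulled inside *)
have yx' : enorm (y - x) = eps by apply/le_anti; rewrite yx andbT; exact: xy.2.
have sE : step_len x y = eps by rewrite /step_len yx'; case: ifP.
have s4 : 0 < s / 4 by lra.
have [r1 r10 h1] := usc_env_near bu xy.1 s4; rewrite -/U in h1.
pose t := Num.min (1 / 2) (r1 / (2 * eps)).
have t0 : 0 < t by rewrite lt_min !divr_gt0// mulr_gt0.
have t1 : t <= 1 / 2 by rewrite /t ge_min lexx.
have tr : t * eps < r1.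
  apply: (@le_lt_trans _ _ (r1 / (2 * eps) * eps)).
    by rewrite ler_wpM2r ?(ltW ep)// /t ge_min lexx orbT.
  have -> : r1 / (2 * eps) * eps = r1 / 2 by field; rewrite gt_eqF.
  lra.
pose y' := x + (1 - t) *: (y - x).
have Oy' : Omega y'.
  apply: convex_segment_closure => //; first exact: xy.1.
  by apply/andP; split; lra.
have y'y : enorm (y' - y) = t * eps.
  have -> : y' - y = (- t) *: (y - x).
    by rewrite /y'; apply/rowP => i; rewrite !mxE; ring.
  by rewrite enormZ normrN gtr0_norm// yx'.
have y'x : enorm (y' - x) = (1 - t) * eps.
  by rewrite /y' addrC addKr enormZ yx' ger0_norm//; lra.
exists (Num.min (t * eps) (s / 4)); first by rewrite lt_min mulr_gt0.
move=> x' Ox'; rewrite lt_min => /andP[x1 x2] ux'.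
have ux2 : U x - s / 4 <= u x'.
  by apply: le_trans ux'; rewrite lerD2l lerN2 ge_min lexx orbT.
exists y'.
  split; first exact: Omega_cl.
  by have := enorm_tri x' x y'; rewrite y'x (enormBC x x'); lra.
have := h1 y' (Omega_cl Oy'); rewrite y'y => /(_ tr).
rewrite step_len_in//; move: ux2 s0; rewrite /s sE; clear - oO cO eps0; lra.
Qed.

Lemma usc_env_subsol u : bounded_cl u -> subsol 0 u -> subsol 0 (usc_env u).
Proof.
move=> bu su x Ox; rewrite subr_le0 leNgt; apply/negP => gap.
have bU : bounded_cl (usc_env u).
  by have [C uC] := bu; exists C; exact: usc_env_bounded.
have b0 := slope_ge0 Ox bU.
set b := slope (usc_env u) x in gap b0; set d := slope _ x in gap.
have [|r1 r10 h1] := @usc_env_slope_up u x (b + (d - b) / 3) bu Ox.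
  by rewrite -/b; lra.
have [||r2 r20 h2] := @usc_env_slope_down u x (b + 2 * (d - b) / 3) bu Ox.
- lra.
- by rewrite -/d; lra.
have [r3 r30 h3] := open_enorm oO Ox.
pose r := Num.min r1 (Num.min r2 r3).
have r0 : 0 < r by rewrite !lt_min r10 r20.
have [x' [_]] := usc_env_approx bu (Omega_cl Ox) r0 r0.
rewrite {1}/r !lt_min => /andP[x1 /andP[x2 x3]] ux'.
have [l1 l2] : r <= r1 /\ r <= r2 by rewrite /r !ge_min !lexx !orbT.
have Ox' := h3 x' x3.
have s1 := h1 x' Ox' x1; have s2 := h2 x' Ox' x2.
have := su x' Ox'.
have : slope u x' <= b + (d - b) / 3 by apply: s1; lra.
have : b + 2 * (d - b) / 3 <= slope (\- u) x' by apply: s2; lra.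
lra.
Qed.

Definition cl_continuous u := forall x e, cl x -> 0 < e ->
  exists2 r, 0 < r & forall y, cl y -> enorm (y - x) < r -> `|u y - u x| < e.

(** The upper envelope of [u] is a subsolution and the lower one a supersolution,
    with the boundary values of [u]; by stability, for arbitrarily small error,
    the upper envelope is at most the lower one. *)
Lemma solution_continuous g u p : bdry_continuous g -> bounded_cl u ->
  subsol 0 u -> subsol 0 (\- u) -> (forall y, bdry y -> u y = g y) -> bdry p ->
  cl_continuous u.
Proof.
move=> gc bu su sv ug bp.
have gcN : bdry_continuous (\- g).
  move=> q e bq e0; have [r r0 h] := gc q e bq e0; exists r => // z bz zq.
  by have := h z bz zq; rewrite -normrN opprD.
have bv := bounded_clN bu; have [C uC] := bu; have [D vD] := bv.
have UC := usc_env_bounded uC; have VD := usc_env_bounded vD.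
have bU : bounded_cl (usc_env u) by exists C.
have bV : bounded_cl (usc_env (\- u)) by exists D.
have sU := usc_env_subsol bu su; have sV := usc_env_subsol bv sv.
have Ub := usc_env_bdry gc bu su ug.
have Vb : forall y, bdry y -> usc_env (\- u) y = (\- g) y.
  by apply: usc_env_bdry => // y yb /=; rewrite ug.
have UV x : cl x -> usc_env u x <= - usc_env (\- u) x.
  move=> cx; apply/ler_addgt0Pr => e e0.
  have [k k0 H] := stability C (ex_intro _ B bO) bp e0.
  have sUk : subsol k (usc_env u) := subsolW (ltW k0) sU.
  have sVk : subsol k (\- (\- usc_env (\- u))).
    by rewrite opp_funK; exact: subsolW (ltW k0) sV.
  apply: (H _ _ UC (bounded_clN bV) sUk sVk _ x cx).
  by move=> y yb; rewrite Ub//= Vb//= opprK.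
move=> x e cx e0; have e20 : 0 < e / 2 by lra.
have [r1 r10 h1] := usc_env_near bu cx e20.
have [r2 r20 h2] := usc_env_near bv cx e20.
exists (Num.min r1 r2); first by rewrite lt_min r10.
move=> y cy; rewrite lt_min => /andP[y1 y2].
have := h1 y cy y1; have := h2 y cy y2; have := UV x cx.
have := usc_env_ge bu cx; have := usc_env_ge bv cx => /=.
move: (usc_env u x) (usc_env _ x) => a b.
by rewrite ltr_norml; clear - oO cO eps0 e0 => *; apply/andP; split; lra.
Qed.

(** * Solutions of the homogeneous equation are nowhere flat *)

Lemma slope_attained u y (Q : R) : cl_continuous u -> bounded_cl u -> Omega y ->
  0 < Q -> Q <= slope u y ->
  exists2 z, nbr y z & Q * step_len y z <= u z - u y.
Proof.
move=> uc bu Oy Q0 Qs; apply: contrapT => no.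
have lt z : nbr y z -> u z - u y < Q * step_len y z.
  by move=> yz; rewrite ltNge; apply/negP => le; apply: no; exists z.
have [r r0 H] : exists2 r, 0 < r & forall z, cl z -> enorm (z - y) <= eps ->
    u z - u y <= (Q - r) * step_len y z.
  apply: (compact_uniform (P := fun r z => enorm (z - y) <= eps ->
    u z - u y <= (Q - r) * step_len y z) compact_cl).
    move=> r r' z r'0 r'r h zy; apply: le_trans (h zy) _.
    by rewrite ler_wpM2r ?(ltW (step_len_gt0 z Oy))// lerD2l lerN2.
  move=> z cz; have [zy|zy] := ltP eps (enorm (z - y)).
    exists (enorm (z - y) - eps); first by rewrite subr_gt0.
    move=> z' cz' z'z z'y.
    by have := enorm_tri y z' z; rewrite (enormBC z z'); lra.
  have yz : nbr y z by [].
  have gap := lt z yz; have d0 := step_len_gt0 z Oy; have dl := step_len_le yz.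
  set d := step_len y z in gap d0 dl.
  pose s := Q * d - (u z - u y); have s0 : 0 < s by rewrite subr_gt0.
  have s20 : 0 < s / 2 by lra.
  pose q := Num.min Q (s / (2 * (Q + d))).
  have Qd : 0 < 2 * (Q + d) by lra.
  have q0 : 0 < q by rewrite lt_min Q0 divr_gt0.
  have qQ : q <= Q by rewrite /q ge_min lexx.
  have qs : q * (2 * (Q + d)) <= s by rewrite -ler_pdivlMr// /q ge_min lexx orbT.
  have [r1 r10 h1] := uc z _ cz s20.
  have [r2 r20 h2] := step_len_lsc q0 zy; rewrite -/d in h2.
  exists (Num.min q (Num.min r1 r2)); first by rewrite lt_min q0 lt_min r10 r20.
  move=> z' cz'; rewrite lt_min => /andP[_]; rewrite lt_min => /andP[z1 z2] z'y.
  have st := h2 z' z2; have := h1 z' cz' z1; rewrite ltr_norml => /andP[_ uz].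
  have p1 : (Q - q) * (d - q) <= (Q - q) * step_len y z'.
    by apply: ler_wpM2l => //; lra.
  have p2 : (Q - q) * step_len y z' <=
      (Q - Num.min q (Num.min r1 r2)) * step_len y z'.
    rewrite ler_wpM2r ?(ltW (step_len_gt0 z' Oy))// lerD2l lerN2.
    by rewrite ge_min lexx.
  apply: le_trans p2; apply: le_trans p1.
  have := sqr_ge0 q; move: uz qs; rewrite /s; clear - oO cO eps0; lra.
have : slope u y <= Q - r by apply: slope_le => // z [cz zy]; exact: H.
lra.
Qed.

(** Equality in the triangle inequality puts [z] on the ray from [x] through
    [y], by strict convexity of the Euclidean norm. *)
Lemma aligned x y z : 0 < enorm (y - x) ->
  enorm (z - x) = enorm (y - x) + enorm (z - y) ->
  z = x + (enorm (z - x) / enorm (y - x)) *: (y - x).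
Proof.
move=> s0 zx; have /enormD_eq : enorm ((y - x) + (z - y)) =
    enorm (y - x) + enorm (z - y) by rewrite addrC addrA subrK.
move=> h; rewrite zx; set s := enorm (y - x) in s0 h *.
have -> : (s + enorm (z - y)) / s = 1 + enorm (z - y) / s.
  by rewrite mulrDl divff// gt_eqF.
rewrite scalerDl scale1r mulrC -scalerA h scalerA mulVf ?gt_eqF// scale1r.
by apply/rowP => i; rewrite !mxE; ring.
Qed.

(** If [u <> k] somewhere, let [Q > 0] be the maximum over the ball of radius
    [s + eps] of the slopes [|u z - k| / th z], where [th z] is the shortest step
    by which [z] is seen from the flat ball of radius [s]. If [Q] is attained at
    some [z] with [|u z - k| = Q * eps], take the one nearest to [x] and the
    point [y] of the segment from [x] to [z] at distance [eps] from [z]; otherwise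
    it is attained at a boundary point [z], and [y] is the point of the flat ball
    nearest to [z]. The equation provides [z'], seen from [y] with slope at least
    [Q] of the opposite sign. By the choice of [z] and [y], equality holds in the
    triangle inequality between [x], [y] and [z']; so [z'] is on the ray from [x]
    through [y], as is [z]. An interior [z'] is, by the choice of [z], as far from
    [x] as [z]. If [z'] is on the boundary, nothing of the closure lies beyond it
    on the ray by convexity, and [z] does not lie before it, being itself on the
    boundary or at the full distance [eps] from [y]. In both cases [z' = z], which
    is absurd since [u - k] has opposite signs at these points. *)
Lemma flat_step u x (k s : R) : cl_continuous u -> bounded_cl u ->
  subsol 0 u -> subsol 0 (\- u) -> Omega x -> 0 < s ->
  (forall y, enorm (y - x) <= s -> Omega y /\ u y = k) ->
  (forall y, cl y -> enorm (y - x) <= eps -> u y = k) ->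
  forall y, cl y -> enorm (y - x) <= s + eps -> u y = k.
Proof.
move=> uc bu su sv Ox s0 flat flat0 y0 cy0 y0x; apply: contrapT => uy0.
have ep := eps0.
pose K := cl `&` [set z | enorm (z - x) <= s + eps].
have cK : compact K.
  by apply: compact_closedI; [exact: compact_cl|exact: closed_enorm_ball].
pose th z := if `[< Omega z >] then eps else enorm (z - x) - s.
have thO z : Omega z -> th z = eps by rewrite /th; case: asboolP.
have thb z : ~ Omega z -> th z = enorm (z - x) - s by rewrite /th; case: asboolP.
have th0 z : 0 < th z.
  have [Oz|Oz] := pselect (Omega z); first by rewrite thO.
  by rewrite thb// subr_gt0 ltNge; apply/negP => /flat[].
have the z : K z -> th z <= eps.
  case=> cz /= zx; have [Oz|Oz] := pselect (Omega z); first by rewrite thO.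
  by rewrite thb//; lra.
have th_lsc z (e : R) : K z -> 0 < e -> exists2 r, 0 < r &
    forall z', enorm (z' - z) < r -> th z - e <= th z'.
  move=> Kz e0; have [Oz|Oz] := pselect (Omega z).
    have [r r0 rO] := open_enorm oO Oz.
    by exists r => // z' /rO Oz'; rewrite !thO//; lra.
  exists e => // z' z'z; have [Oz'|Oz'] := pselect (Omega z').
    by have := the z Kz; rewrite (thO z')//; lra.
  rewrite !thb//; have := enorm_tri x z' z; rewrite (enormBC z z').
  by move: z'z; clear - oO cO eps0; lra.
have absc z (e : R) : K z -> 0 < e -> exists2 r, 0 < r & forall z', K z' ->
    enorm (z' - z) < r -> `|u z' - k| < `|u z - k| + e.
  case=> cz _ e0; have [r r0 h] := uc z e cz e0; exists r => // z' [cz' _] z'z.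
  have := h z' cz' z'z; have := ler_normD (u z' - u z) (u z - k).
  by rewrite addrA subrK; clear - oO cO eps0; lra.
have Ky0 : K y0 by [].
pose phi z : R := `|u z - k| / th z.
have [zm Kzm phimax] : exists2 z, K z & forall z', K z' -> phi z' <= phi z.
  apply: usc_max => //; first by exists y0.
  move=> z e Kz e0.
  have p0 : 0 <= phi z by rewrite divr_ge0// ltW.
  have te : 0 < e * th z / 2 by rewrite divr_gt0// mulr_gt0.
  have [r1 r10 h1] := absc z _ Kz te.
  have pe : 0 < 4 * (phi z + e) by lra.
  have d0 : 0 < e * th z / (4 * (phi z + e)) by rewrite divr_gt0// mulr_gt0.
  have [r2 r20 h2] := th_lsc z _ Kz d0.
  exists (Num.min r1 r2); first by rewrite lt_min r10.
  move=> z' Kz'; rewrite lt_min => /andP[z1 z2].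
  rewrite /phi ltr_pdivrMr//; apply: lt_le_trans (h1 z' Kz' z1) _.
  have : (phi z + e) * (th z - e * th z / (4 * (phi z + e))) <=
         (phi z + e) * th z'.
    by apply: ler_wpM2l; [lra|exact: h2].
  have -> : (phi z + e) * (th z - e * th z / (4 * (phi z + e))) =
      phi z * th z + e * th z * (3 / 4).
    by field; rewrite gt_eqF//; lra.
  have -> : phi z * th z = `|u z - k| by rewrite divfK// gt_eqF.
  by rewrite -/(phi z); move: te; clear - oO cO eps0; lra.
pose Q : R := phi zm.
have Q0 : 0 < Q.
  apply: lt_le_trans (phimax y0 Ky0); rewrite divr_gt0// normr_gt0 subr_eq0.
  exact/eqP.
have Qle z : K z -> `|u z - k| <= Q * th z.
  by move=> Kz; rewrite -ler_pdivrMr//; exact: phimax.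
(* [y] sees from inside the flat ball the slope [Q] at [z], in the direction
   away from [x] *)
have key y z : Omega y -> u y = k -> 0 < enorm (y - x) -> enorm (y - x) <= s ->
    nbr y z -> enorm (z - x) = enorm (y - x) + enorm (z - y) ->
    Q * step_len y z <= `|u z - k| ->
    (~ Omega z \/ enorm (z - x) = enorm (y - x) + eps) ->
    (forall z', K z' -> Q * eps <= `|u z' - k| ->
       enorm (z - x) <= enorm (z' - x) /\
       enorm (z - x) = enorm (y - x) + eps) -> False.
  move=> Oy uy; set sg := enorm (y - x) => sg0 sgs yz Dz sl zO zmin.
  set D := enorm (z - x) in Dz zO zmin *.
  have D0 : 0 < D by have := enorm_ge0 (z - y); rewrite Dz; lra.
  have suffw w : cl_continuous w -> bounded_cl w ->
      slope w y <= slope (\- w) y -> (forall t : 'rV[R]_n, `|w t - w y| = `|u t - k|) ->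
      Q * step_len y z <= w z - w y -> False.
    move=> wc bw sw wu wz.
    have st0 := step_len_gt0 z Oy.
    have Qs : Q <= slope (\- w) y.
      apply: le_trans sw; rewrite -(ler_pM2r st0).
      exact: le_trans (slope_ub Oy bw yz).
    have wcN : cl_continuous (\- w).
      move=> t' e ct e0; have [r r0 h] := wc t' e ct e0.
      by exists r => // t2 ct2 tt; have := h t2 ct2 tt; rewrite -normrN opprD.
    have [z' yz' wz'] := slope_attained wcN (bounded_clN bw) Oy Q0 Qs.
    rewrite /= in wz'.
    have uz' : Q * step_len y z' <= `|u z' - k|.
      rewrite -wu; have := ler_norm (w y - w z'); rewrite distrC.
      by move: wz'; clear - oO cO eps0; lra.
    suff zz : z' = z.
      have : 0 < Q * step_len y z by rewrite mulr_gt0.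
      by move: wz wz'; rewrite zz; clear - oO cO eps0; lra.
    set D' := enorm (z' - x).
    have D'le : D' <= sg + enorm (z' - y) by exact: enorm_tri.
    have Kz' : K z'.
      split; first exact: yz'.1.
      by have := yz'.2; rewrite /= -/D'; move: sgs D'le; clear - oO cO eps0; lra.
    have al : D' = sg + enorm (z' - y) -> D' = D -> z' = z.
      move=> D'E D'D; rewrite (aligned sg0 D'E) (aligned sg0 Dz).
      by rewrite -/D' -/D D'D.
    have [Oz'|Oz'] := pselect (Omega z').
      rewrite step_len_in// in uz'; have [DD' DE] := zmin z' Kz' uz'.
      have := yz'.2 => z'y.
      have E1 : D' = D.
        apply/le_anti; rewrite DD' andbT.
        by move: D'le z'y DE; clear - oO cO eps0; lra.
      apply: al => //; apply/le_anti; rewrite D'le /=.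
      by move: z'y DE; rewrite E1; clear - oO cO eps0; lra.
    rewrite step_len_bd// in uz'.
    have := le_trans uz' (Qle z' Kz'); rewrite (ler_pM2l Q0) thb// -/D' => h.
    have D'E : D' = sg + enorm (z' - y).
      apply/le_anti; rewrite D'le /=.
      by move: sgs h; clear - oO cO eps0; lra.
    apply: al => //.
    have D'0 : 0 < D'.
      by have := enorm_ge0 (z' - y); move: sg0 D'E; clear - oO cO eps0; lra.
    have z'E : z' = x + (D' / D) *: (z - x).
      rewrite {1}(aligned sg0 D'E) [z in RHS](aligned sg0 Dz) -/D' -/D.
      rewrite [x + _ - x]addrC addKr scalerA mulrA divfK ?gt_eqF//.
    have zE : z = x + (D / D') *: (z' - x).
      rewrite z'E [x + _ - x]addrC addKr scalerA.
      have -> : D / D' * (D' / D) = 1 by field; rewrite !gt_eqF.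
      by rewrite scale1r addrC subrK.
    have [lt|lt|//] := ltgtP D' D.
      case: Oz'; rewrite z'E; apply: convex_segment_closure => //.
        exact: yz.1.
      by rewrite divr_ge0 ?ltW//= ltr_pdivrMr// mul1r.
    have Oz : Omega z.
      rewrite zE; apply: convex_segment_closure => //; first exact: yz'.1.
      by rewrite divr_ge0 ?ltW//= ltr_pdivrMr// mul1r.
    case: zO => // DE; have := yz'.2.
    by move: D'E DE lt; clear - oO cO eps0; lra.
  have suy := su y Oy; have := sv y Oy; rewrite opp_funK => svy.
  have [uzk|uzk] := leP 0 (u z - k).
    apply: (suffw u) => //; first lra.
      by move=> t; rewrite uy.
    by rewrite uy -(ger0_norm uzk).
  apply: (suffw (\- u)) => //.
  - move=> t' e ct e0; have [r r0 h] := uc t' e ct e0.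
    by exists r => // t2 ct2 tt; have := h t2 ct2 tt; rewrite -normrN opprD.
  - exact: bounded_clN.
  - by rewrite opp_funK; lra.
  - by move=> t; rewrite /= -opprD normrN uy.
  - by move: sl; rewrite (ltr0_norm uzk) /= uy; clear - oO cO eps0; lra.
have mk z (sg : R) : 0 < sg -> sg < enorm (z - x) -> sg <= s -> exists y,
    [/\ Omega y, u y = k, enorm (y - x) = sg &
        enorm (z - y) = enorm (z - x) - sg].
  move=> sg0 sgD sgs; set D := enorm (z - x) in sgD *.
  have D0 : 0 < D by exact: lt_trans sgD.
  have E1 : enorm (x + (sg / D) *: (z - x) - x) = sg.
    rewrite addrC addKr enormZ ger0_norm ?divr_ge0 ?ltW// -/D divfK//.
    by rewrite gt_eqF.
  have [Oy uy] : Omega (x + (sg / D) *: (z - x)) /\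
      u (x + (sg / D) *: (z - x)) = k by apply: flat; rewrite E1.
  exists (x + (sg / D) *: (z - x)); split => //.
  have -> : z - (x + (sg / D) *: (z - x)) = (1 - sg / D) *: (z - x).
    by apply/rowP => i; rewrite !mxE; ring.
  have sD : sg / D <= 1 by rewrite ler_pdivrMr// mul1r ltW.
  by rewrite enormZ -/D ger0_norm ?subr_ge0// mulrBl mul1r divfK// gt_eqF.
have [[z1 Kz1 z1Q]|noQ] := pselect (exists2 z, K z & Q * eps <= `|u z - k|).
  pose psi z := if Q * eps <= `|u z - k| then - enorm (z - x) else - (s + eps + 1).
  have [z Kz psimax] : exists2 z, K z & forall z', K z' -> psi z' <= psi z.
    apply: usc_max => //; first by exists z1.
    move=> z e Kz e0; rewrite /psi; case: (leP (Q * eps) `|u z - k|) => [Qz|Qz].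
      exists e => // z' Kz' z'z; have := Kz.2 => /= zx.
      have := enorm_tri x z' z; rewrite (enormBC z z').
      by case: (leP (Q * eps) `|u z' - k|) => _; move: z'z zx e0; clear - oO cO eps0; lra.
    have gap : 0 < Q * eps - `|u z - k| by rewrite subr_gt0.
    have [r r0 h] := absc z _ Kz gap; exists r => // z' Kz' z'z.
    have lt : `|u z' - k| < Q * eps.
      by have := h z' Kz' z'z; clear - oO cO eps0; lra.
    by rewrite leNgt lt /= ltrDl.
  have zQ : Q * eps <= `|u z - k|.
    have := psimax z1 Kz1; rewrite /psi z1Q; case: (leP (Q * eps) `|u z - k|) => // _.
    by have := Kz1.2 => /= h1 h2; exfalso; move: h1 h2; clear - oO cO eps0; lra.
  have zmin z' : K z' -> Q * eps <= `|u z' - k| -> enorm (z - x) <= enorm (z' - x).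
    by move=> Kz' z'Q; have := psimax z' Kz'; rewrite /psi zQ z'Q lerN2.
  have zeps : eps < enorm (z - x).
    rewrite ltNge; apply/negP => /(flat0 z Kz.1) uz.
    move: zQ; rewrite uz subrr normr0 leNgt => /negP; apply.
    by rewrite mulr_gt0.
  have zs := Kz.2; rewrite /= in zs.
  have [|||y [Oy uy yx zy]] := mk z (enorm (z - x) - eps) _ _ _; try lra.
  have zyE : enorm (z - y) = eps by rewrite zy; lra.
  have yz : nbr y z by split; [exact: Kz.1|rewrite zyE].
  apply: (key y z) => //.
  - by rewrite yx; lra.
  - by rewrite yx; lra.
  - by rewrite yx zyE subrK.
  - apply: le_trans zQ; rewrite ler_wpM2l ?(ltW Q0)//; exact: step_len_le.
  - by right; rewrite yx subrK.
  - by move=> z' Kz' z'Q; split; [exact: zmin|rewrite yx subrK].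
have zmQ : `|u zm - k| = Q * th zm by rewrite /Q divfK// gt_eqF.
have Ozm : ~ Omega zm.
  by move=> Ozm; apply: noQ; exists zm => //; rewrite zmQ thO.
have zms : s < enorm (zm - x) by rewrite ltNge; apply/negP => /flat[].
have [y [Oy uy yx zy]] := mk zm s s0 zms (lexx s).
have yz : nbr y zm.
  by split; [exact: Kzm.1|rewrite zy; have := Kzm.2 => /=; lra].
apply: (key y zm) => //.
- by rewrite yx.
- by rewrite yx.
- by rewrite yx zy; lra.
- by rewrite step_len_bd// zy zmQ thb.
- by left.
- by move=> z' Kz' z'Q; case: noQ; exists z'.
Qed.
(** Otherwise [flat_step] extends the flatness, by [eps] at a time, to all points
    of the closure slightly farther from [x] than the nearest boundary point [q],
    and [g] would be constant near [q]. *)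
Lemma nowhere_flat g u p x : (forall q r, bdry q -> 0 < r -> exists q',
    [/\ bdry q', enorm (q' - q) < r & g q' <> g q]) ->
  cl_continuous u -> bounded_cl u -> subsol 0 u -> subsol 0 (\- u) ->
  (forall y, bdry y -> u y = g y) -> bdry p -> Omega x ->
  exists y, [/\ cl y, enorm (y - x) < eps & u y <> u x].
Proof.
move=> gn uc bu su sv ug bp Ox; apply: contrapT => no.
have ep := eps0.
have flat_lt y : cl y -> enorm (y - x) < eps -> u y = u x.
  by move=> cy yx; apply: contrapT => uy; apply: no; exists y.
have flat0 y : cl y -> enorm (y - x) <= eps -> u y = u x.
  move=> cy; rewrite le_eqVlt => /orP[/eqP yx|]; last exact: flat_lt.
  apply: contrapT => /eqP; rewrite -subr_eq0 -normr_gt0 => gap.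
  have [r r0 h] := uc y _ cy gap.
  pose t := Num.min (1 / 2) (r / (2 * eps)).
  have t0 : 0 < t by rewrite lt_min !divr_gt0// mulr_gt0.
  have t1 : t <= 1 / 2 by rewrite /t ge_min lexx.
  have tr : t * eps < r.
    apply: (@le_lt_trans _ _ (r / (2 * eps) * eps)).
      by rewrite ler_wpM2r ?(ltW ep)// /t ge_min lexx orbT.
    have -> : r / (2 * eps) * eps = r / 2 by field; rewrite gt_eqF.
    lra.
  pose y' := x + (1 - t) *: (y - x).
  have Oy' : Omega y'.
    by apply: convex_segment_closure => //; apply/andP; split; lra.
  have y'y : enorm (y' - y) < r.
    have -> : y' - y = (- t) *: (y - x).
      by rewrite /y'; apply/rowP => i; rewrite !mxE; ring.
    by rewrite enormZ normrN gtr0_norm// yx.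
  have y'x : enorm (y' - x) < eps.
    rewrite /y' addrC addKr enormZ yx ger0_norm; last lra.
    by rewrite mulrBl mul1r gtrBl mulr_gt0.
  have := h y' (Omega_cl Oy') y'y.
  by rewrite (flat_lt y' (Omega_cl Oy') y'x) distrC ltxx.
have [q bq qmin] : exists2 q, bdry q & forall q', bdry q' ->
    enorm (q - x) <= enorm (q' - x).
  have cb : compact (cl `&` ~` Omega).
    by apply: compact_closedI; [exact: compact_cl|exact: open_closedC].
  have [||q bq qmax] := @usc_max _ _ _ (fun z => - enorm (z - x)) cb.
  - by exists p; exact: bp.
  - move=> z e _ e0; exists e => // z' _ z'z.
    by have := enorm_tri x z' z; rewrite (enormBC z z'); lra.
  by exists q => // q' bq'; have := qmax q' bq'; rewrite lerN2.
have inside y : enorm (y - x) < enorm (q - x) -> Omega y.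
  move=> yq; apply: contrapT => Oy.
  have [t /andP[t0 t1] bt] := exit_bdry Ox Oy.
  have := qmin _ bt; have -> : x + t *: (y - x) - x = t *: (y - x).
    by rewrite addrC addKr.
  rewrite enormZ gtr0_norm//.
  have := enorm_ge0 (y - x); nra.
suff [d d0 flat] : exists2 d, 0 < d &
    forall y, cl y -> enorm (y - x) < enorm (q - x) + d -> u y = u x.
  have [q' [bq' q'q []]] := gn q d bq d0.
  rewrite -!ug// !flat ?ltrDl//; [exact: bq.1|exact: bq'.1|].
  by apply: le_lt_trans (enorm_tri x q q') _; rewrite ltrD2l.
set D := enorm (q - x) in qmin inside *.
have [De|De] := ltP D eps.
  exists (eps - D); first by rewrite subr_gt0.
  by move=> y cy yD; apply: flat_lt => //; lra.
exists (eps / 2); first by rewrite divr_gt0.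
have rs0 : 0 < D - eps / 2 by lra.
pose s (m : nat) := Num.min (m.+1%:R * eps) (D - eps / 2).
have sm0 m : 0 < s m by rewrite lt_min mulr_gt0.
have sD m : s m <= D - eps / 2 by rewrite /s ge_min lexx orbT.
have flat m y : enorm (y - x) <= s m -> Omega y /\ u y = u x.
  elim: m y => [|m IH] y yx; have Oy : Omega y.
  - by apply: inside; have := sD 0%N; lra.
  - split=> //; apply: flat0; first exact: Omega_cl.
    by apply: le_trans yx _; rewrite /s mul1r ge_min lexx.
  - by apply: inside; have := sD m.+1; lra.
  split=> //; apply: (flat_step uc bu su sv Ox (sm0 m) IH flat0).
    exact: Omega_cl.
  have [y1 y2] : enorm (y - x) <= m.+2%:R * eps /\ enorm (y - x) <= D - eps / 2.
    have [l1 l2] := min_le2 (m.+2%:R * eps) (D - eps / 2).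
    by split; exact: le_trans yx _.
  rewrite /s; case: (leP (m.+1%:R * eps) (D - eps / 2)) => _; last lra.
  by move: y1; rewrite -(natr1 m.+1) mulrDl mul1r.
pose m := Num.bound (D / eps).
have mD : D < m%:R * eps.
  by rewrite -ltr_pdivrMr//; apply: archi_boundP; apply: divr_ge0; lra.
have sE : s m = D - eps / 2.
  rewrite /s; apply/min_idPr; apply: (@le_trans _ _ (m%:R * eps)); first lra.
  by rewrite ler_wpM2r ?(ltW ep)// ler_nat.
move=> y cy yD; apply: (flat_step uc bu su sv Ox (sm0 m) (flat m) flat0) => //.
by rewrite sE; lra.
Qed.

(** The gap is stated for values and not for slopes, to be stable under uniform
    perturbations of [u]. *)
Lemma uniform_gap u : cl_continuous u ->
  (forall x, cl x -> exists y, [/\ cl y, enorm (y - x) < eps & u y <> u x]) ->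
  exists2 c, 0 < c & forall x, cl x ->
    exists y, [/\ cl y, enorm (y - x) <= eps & c <= `|u y - u x|].
Proof.
move=> uc un; apply: (compact_uniform (P := fun c x => exists y,
  [/\ cl y, enorm (y - x) <= eps & c <= `|u y - u x|]) compact_cl).
  move=> c c' x _ c'c [y [cy yx uy]]; exists y; split => //.
  exact: le_trans uy.
move=> x cx; have [y [cy yx /eqP]] := un x cx.
rewrite -subr_eq0 -normr_gt0 => gap.
have gap2 : 0 < `|u y - u x| / 2 by rewrite divr_gt0.
have [r r0 h] := uc x _ cx gap2.
pose d := eps - enorm (y - x); have d0 : 0 < d by rewrite subr_gt0.
exists (Num.min r (Num.min d (`|u y - u x| / 2))).
  by rewrite lt_min r0 lt_min d0.
move=> x' cx'; rewrite lt_min => /andP[x1]; rewrite lt_min => /andP[x2 x3].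
exists y; split => //.
  by have := enorm_tri x' x y; rewrite (enormBC x x') /d in x2 *; lra.
have := h x' cx' x1; have := ler_normD (u y - u x') (u x' - u x).
rewrite addrA subrK; have := min_le2 r (Num.min d (`|u y - u x| / 2)).
have := min_le2 d (`|u y - u x| / 2).
by move=> [_ l1] [_ l2]; move: l1 l2; clear - oO cO eps0; lra.
Qed.

(** * Existence and uniqueness for a small right-hand side *)

Definition solution (f g u : 'rV[R]_n -> R) : Prop :=
  [/\ bounded_cl u, forall y, bdry y -> u y = g y &
      forall x, Omega x -> slope (\- u) x - slope u x = eps * f x].

Lemma solution_subsol f g u k : solution f g u ->
  (forall x, Omega x -> `|eps * f x| <= k) -> subsol k u /\ subsol k (\- u).
Proof.
move=> [_ _ uf] fk; split => x Ox; have /ler_normlP[? ?] := fk x Ox.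
  by rewrite uf.
by rewrite opp_funK; have := uf x Ox; lra.
Qed.

(** Negation exchanges subsolutions and supersolutions, and with them the upper
    and lower bounds. *)
Lemma solution_bound g G : (forall y, bdry y -> `|g y| <= G) ->
  exists C, forall f u, solution f g u ->
  (forall x, Omega x -> `|eps * f x| <= eps) -> forall x, cl x -> `|u x| <= C.
Proof.
move=> gG; have [C1 H1] := subsol_upper_bound gG.
have gG' y : bdry y -> `|(\- g) y| <= G by move=> /gG /=; rewrite normrN.
have [C2 H2] := subsol_upper_bound gG'.
exists (Num.max C1 C2) => f u sol fe x cx.
have [su sv] := solution_subsol sol fe; have [bu ug _] := sol.
have h1 : u x <= C1 by apply: H1 => // y yb; rewrite ug.
have h2 : (\- u) x <= C2.
  by apply: H2 => //; [exact: bounded_clN|move=> y yb /=; rewrite ug].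
by apply/ler_normlP; split; rewrite le_max ?h1 ?h2 ?orbT.
Qed.

(** Let [c] be the gap of the homogeneous solution [u0]. Solutions for small [f]
    stay within [c / 4] of [u0], so at every point one of their slopes is at least
    [c / (2 * eps)]; as the two slopes differ by at most [eps * |f|], the upward
    slope is bounded below and [ascent_comparison] applies. *)
Lemma well_posed g G p : bdry_continuous g -> bdry p ->
  (forall y, bdry y -> `|g y| <= G) ->
  (forall q r, bdry q -> 0 < r -> exists q',
    [/\ bdry q', enorm (q' - q) < r & g q' <> g q]) ->
  exists2 d, 0 < d & forall f, (forall x, Omega x -> `|f x| <= d) ->
  exists2 u, solution f g u &
    forall v, solution f g v -> forall x, cl x -> v x = u x.
Proof.
move=> gc bp gG gn; have ep := eps0.
have f01 x : Omega x -> `|(fun=> 0 : R) x| <= 1 by rewrite normr0.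
have [u0 sol0] : exists u0, solution (fun=> 0) g u0.
  by have [u [? ? ?]] := perron gG f01; exists u.
have [bu0 u0g _] := sol0.
have [su0 sv0] : subsol 0 u0 /\ subsol 0 (\- u0).
  by apply: (solution_subsol sol0) => x _; rewrite mulr0 normr0.
have uc0 := solution_continuous gc bu0 su0 sv0 u0g bp.
have [c c0 gap] : exists2 c, 0 < c & forall x, cl x ->
    exists y, [/\ cl y, enorm (y - x) <= eps & c <= `|u0 y - u0 x|].
  apply: uniform_gap => // x cx; have [Ox|Ox] := pselect (Omega x).
    exact: nowhere_flat gn uc0 bu0 su0 sv0 u0g bp Ox.
  have bx : bdry x by [].
  have [q [bq qx gq]] := gn x eps bx ep.
  by exists q; rewrite !u0g//; split => //; exact: bq.1.
have [C HC] := solution_bound gG.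
have u0C : forall x, cl x -> `|u0 x| <= C.
  by apply: HC sol0 _ => x _; rewrite mulr0 normr0 ltW.
have c4 : 0 < c / 4 by lra.
have [k k0 stab] := stability C (ex_intro _ B bO) bp c4.
pose d := Num.min 1 (Num.min (k / eps) (c / (4 * eps) / eps)).
have d0 : 0 < d by rewrite !lt_min ltr01 !divr_gt0// mulr_gt0.
have [d1 [dk dc]] : d <= 1 /\ d <= k / eps /\ d <= c / (4 * eps) / eps.
  by rewrite /d !ge_min !lexx !orbT.
exists d => // f fd.
have fl l : d <= l / eps -> forall x, Omega x -> `|eps * f x| <= l.
  move=> dl x Ox; rewrite normrM gtr0_norm// mulrC -ler_pdivlMr//.
  exact: le_trans (fd x Ox) dl.
have f1 x : Omega x -> `|f x| <= 1 by move=> Ox; exact: le_trans (fd x Ox) d1.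
have fe x : Omega x -> `|eps * f x| <= eps.
  by apply: fl; rewrite divff ?gt_eqF.
have steep v : solution f g v -> forall x, Omega x -> c / (4 * eps) <= slope v x.
  move=> sol x Ox; have [bv vg vf] := sol.
  have vC := HC f v sol fe.
  have [sv svN] := solution_subsol sol (fl k dk).
  have h1 : forall y, cl y -> v y <= u0 y + c / 4.
    apply: stab => //; first exact: subsolW (ltW k0) sv0.
    by move=> y yb; rewrite vg// u0g.
  have h2 : forall y, cl y -> u0 y <= v y + c / 4.
    apply: stab => //; first exact: subsolW (ltW k0) su0.
    by move=> y yb; rewrite vg// u0g.
  have cx := Omega_cl Ox.
  have [y [cy yx guy]] := gap x cx; have xy : nbr x y by [].
  have far w : bounded_cl w -> c / 2 <= w y - w x -> c / (2 * eps) <= slope w x.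
    move=> bw wyx; rewrite -(ler_pM2r ep).
    have -> : c / (2 * eps) * eps = c / 2 by field; rewrite gt_eqF.
    apply: le_trans wyx _; apply: le_trans (slope_ub Ox bw xy) _.
    by rewrite ler_wpM2l ?slope_ge0// step_len_le.
  have cE : c / (2 * eps) = c / (4 * eps) + c / (4 * eps).
    by field; rewrite gt_eqF.
  have p4 : 0 < c / (4 * eps) by rewrite divr_gt0// mulr_gt0.
  have := h1 y cy; have := h2 y cy; have := h1 x cx; have := h2 x cx.
  have [uyx|uyx] := leP 0 (u0 y - u0 x).
    rewrite ger0_norm// in guy => l1 l2 l3 l4.
    have := far v bv; rewrite cE; move: l1 l2 l3 l4 guy p4.
    move=> l1 l2 l3 l4 guy p4 h; apply: le_trans (h _); last lra.
    by rewrite lerDl ltW.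
  rewrite ltr0_norm// in guy => l1 l2 l3 l4.
  have := far (\- v) (bounded_clN bv); rewrite cE /= => h.
  have := fl _ dc x Ox => /ler_normlP[_ fx].
  have := h _; have vfx := vf x Ox => h'.
  have : c / (4 * eps) + c / (4 * eps) <= slope (\- v) x by apply: h'; lra.
  lra.
have [u [bu ug uf]] := perron gG f1.
have solu : solution f g u by [].
have c4e : 0 < c / (4 * eps) by rewrite divr_gt0// mulr_gt0.
have cmp v w : solution f g v -> solution f g w -> forall x, cl x -> v x <= w x.
  move=> solv solw; have [bv vg vf] := solv; have [bw wg wf] := solw.
  apply: (ascent_comparison bv bw _ _ c4e (steep v solv)).
    by move=> y yb; rewrite vg// wg.
  by move=> x Ox; rewrite vf// wf.
exists u => // v solv x cx; apply/le_anti; apply/andP.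
by split; [exact: (cmp v u)|exact: (cmp u v)].
Qed.

Lemma slope_upE u x : Omega x -> slope_up Omega eps u x = slope u x.
Proof.
move=> Ox; rewrite /slope_up /slope; congr sup.
have dE y : cl y -> path_dist Omega x y = (enorm (y - x))%:E.
  by move=> cy; apply: path_distE => //; exact: Omega_cl.
have nE : closed_path_ball Omega x eps = nbr x.
  by apply/seteqP; split=> y [cy h]; split => //; move: h; rewrite dE// lee_fin.
have rE y : nbr x y -> rho Omega eps x y = step_len x y.
  move=> [cy yx]; rewrite /rho dE//.
  rewrite /step_len /=; have [Oy|Oy] := pselect (Omega y).
    by rewrite !asboolT//; apply/max_idPr.
  by rewrite !asboolF// => -[].
by rewrite nE; apply: eq_imagel => y xy; rewrite rE.
Qed.

Lemma slope_downE u x : Omega x -> slope_down Omega eps u x = slope (\- u) x.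
Proof.
move=> Ox; rewrite -slope_upE// /slope_down /slope_up; congr sup.
by apply: eq_imagel => y _ /=; rewrite opprK addrC.
Qed.

Lemma bounded_solutionP f g u : solution f g u <-> bounded_solution Omega eps f g u.
Proof.
have bE : bounded_cl u <-> [bounded u x | x in cl].
  split=> [[C uC]|[C [_ uC]]].
    exists C; split; first exact: num_real.
    by move=> M CM x cx /=; apply: le_trans (uC x cx) _; exact: ltW.
  by exists (C + 1); apply: uC; rewrite ltrDl.
have lE x : Omega x ->
    (- inf_laplacian Omega eps u x = f x <-> slope (\- u) x - slope u x = eps * f x).
  move=> Ox; rewrite /inf_laplacian slope_upE// slope_downE//.
  have -> : - (eps^-1 * (slope u x - slope (\- u) x)) =
    eps^-1 * (slope (\- u) x - slope u x) by ring.
  split=> [<-|->]; first by rewrite mulrA divff ?gt_eqF// mul1r.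
  by rewrite mulrA mulVf ?gt_eqF// mul1r.
split=> -[bu h1 h2]; split.
- exact/bE.
- by move=> x Ox; apply/lE => //; exact: h2.
- by move=> x /(boundary_openP x oO); exact: h1.
- exact/bE.
- by move=> y yb; apply: h2; apply/boundary_openP.
- by move=> x Ox; apply/lE => //; exact: h1.
Qed.

End DiscreteEquation.

(** * The boundary-value problem *)

Theorem theorem2p10 (R : realType) (n : nat) (n_gt0 : (0 < n)%N)
    (Omega : set 'rV[R]_n)
    (Omega_open : open Omega)
    (Omega_connected : connected Omega)
    (Omega_bounded : bounded_set Omega)
    (g : 'rV[R]_n -> R)
    (g_cont : {within boundary Omega, continuous g})
    (Omega_convex : convex_set Omega)
    (g_nonconst : forall (x0 : 'rV[R]_n) (r : R),
      boundary Omega x0 -> 0 < r ->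
      ~ (exists c : R, forall x, (boundary Omega `&` eball x0 r) x -> g x = c)) :
  forall eps : R, 0 < eps ->
  exists2 delta : R, 0 < delta &
    forall f : 'rV[R]_n -> R,
      {within Omega, continuous f} ->
      (Linfty_norm Omega f < +oo)%E ->
      (Linfty_norm Omega f <= delta%:E)%E ->
      exists2 u : 'rV[R]_n -> R, bounded_solution Omega eps f g u &
        forall v : 'rV[R]_n -> R, bounded_solution Omega eps f g v ->
          forall x, closure Omega x -> v x = u x.
Proof.
move=> eps eps0.
have [[x0 Ox0]|empty] := pselect (exists x, Omega x); last first.
  have noc x : ~ closure Omega x.
    by move=> /closure_enormP/(_ 1 ltr01)[y Oy _]; apply: empty; exists y.
  exists 1 => // f _ _ _; exists g; last by move=> v _ x /noc.
  split=> [|x Ox|//]; last by case: empty; exists x.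
  by exists 0; split => // M _ x /noc.
have bP x := boundary_openP x Omega_open.
have [B bB] : exists B, forall x, Omega x -> enorm x <= B.
  have [M [_ hM]] := Omega_bounded; exists (n%:R * (M + 1)) => x Ox.
  apply: le_trans (enorm_le_norm x) _; apply: ler_wpM2l => //.
  by apply: hM Ox; rewrite ltrDl.
pose i0 := Ordinal n_gt0.
have [p bp] : exists p, bdry (Omega := Omega) p.
  pose w : 'rV[R]_n := const_mx (B + 1).
  have [|t _ bt] := @exit_bdry _ _ _ Omega_open x0 w Ox0.
    move=> /bB; have := coord_le_enorm w i0; rewrite mxE.
    by have := ler_norm (B + 1); lra.
  by eexists; exact: bt.
have gc : bdry_continuous (Omega := Omega) g.
  move=> q e bq e0.
  have bq' : boundary Omega q by exact/bP.
  have : within (boundary Omega) (nbhs q) [set t | `|g q - g t| < e].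
    rewrite nbhs_subspace_in//.
    by have /cvgrPdist_lt/(_ e e0) := g_cont q.
  move=> /nbhs_enormP[r r0 h]; exists r => // z bz zr.
  by rewrite distrC; apply: h => //; exact/bP.
have gn q r : bdry (Omega := Omega) q -> 0 < r -> exists q',
    [/\ bdry (Omega := Omega) q', enorm (q' - q) < r & g q' <> g q].
  move=> bq r0; apply: contrapT => no; apply: (g_nonconst q r _ r0).
    exact/bP.
  exists (g q) => z [/bP bz zr]; apply: contrapT => gz.
  by apply: no; exists z.
have [G gG] : exists G, forall y, bdry (Omega := Omega) y -> `|g y| <= G.
  have cb : compact (closure Omega `&` ~` Omega).
    apply: compact_closedI; first exact: compact_cl bB.
    exact: open_closedC.
  have [r r0 h] : exists2 r, 0 < r & forall x, (closure Omega `&` ~` Omega) x ->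
      `|g x| <= r^-1.
    apply: (compact_uniform (P := fun r x => `|g x| <= r^-1) cb).
      move=> r r' x r'0 r'r h; apply: le_trans h _.
      by rewrite lef_pV2// posrE (lt_le_trans r'0).
    move=> x bx; have [r r0 h] := gc x 1 bx ltr01.
    have p1 : 0 < `|g x| + 1 by rewrite ltr_pwDr.
    exists (Num.min r (`|g x| + 1)^-1); first by rewrite lt_min r0 invr_gt0.
    move=> y yb; rewrite lt_min => /andP[yr _].
    apply: (@le_trans _ _ (`|g x| + 1)).
      have := h y yb yr; have := ler_normD (g y - g x) (g x).
      by rewrite subrK; lra.
    rewrite -[leLHS]invrK lef_pV2 ?posrE ?lt_min ?r0 ?invr_gt0//.
    by rewrite ge_min lexx orbT.
  by exists r^-1.
have [d d0 H] := well_posed Omega_open Omega_convex eps0 i0 bB gc bp gG gn.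
exists d => // f fc _ fd.
have [|u su uniq] := H f; first exact: Linfty_norm_pointwise fd.
exists u; first by apply/bounded_solutionP.
by move=> v /bounded_solutionP sv; apply: uniq; exact: sv.
Qed.
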